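(* Let $\Bbbk$ be an infinite field, let $m\ge1$ and $0<k<n$ be integers, and let $\mathfrak{F}=\{V_1,\dots,V_m;W_1,\dots,W_m\}$ be a family of subspaces of $C$ with $\dim V_i=k$ and $\operatorname{codim}W_i=k$ for all $i$. The algebra $R_{\mathfrak{F}}=\Bbbk Q_{n,m}/I_{\mathfrak{F}}$ has finite global dimension if and only if the quiver $\Gamma_{\mathfrak{F}}$ does not have oriented cycles. Moreover, the global dimension of $R_{\mathfrak{F}}$ is equal to $l+2$, where $l$ is the maximal length of a path in $\Gamma_{\mathfrak{F}}$.
   Context: $Q_{n,m}$ is the quiver with two vertices $\mathbf{1},\mathbf{2}$, with $n$ arrows $c_1,\dots,c_n$ from $\mathbf{1}$ to $\mathbf{2}$ and $m$ arrows $b_1,\dots,b_m$ from $\mathbf{2}$ to $\mathbf{1}$. Its path algebra $\Bbbk Q_{n,m}$ is generated by idempotents $e_1,e_2$ and the arrows, with $e_{t(a)}a=ae_{s(a)}=a$ (so paths are composed right to left: $c_j=e_2c_je_1$, $b_i=e_1b_ie_2$). $C$ and $B$ are the vector spaces spanned by $c_1,\dots,c_n$ and by $b_1,\dots,b_m$, respectively. $I_{\mathfrak{F}}$ is the two-sided ideal generated by the relations: (1) $bcb'=0$ for all $c\in C$, $b,b'\in B$; (2) $wb_i=0$ for all $w\in W_i$, $i=1,\dots,m$; (3) $b_iv=0$ for all $v\in V_i$, $i=1,\dots,m$. Put $t_{ij}=\dim(V_i\cap W_j)$. The quiver $\Gamma_{\mathfrak{F}}$ has $2m$ vertices, denoted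 $b_1,\dots,b_m,v_1,\dots,v_m$, and the following arrows: one arrow $b_i\to v_i$ for each $i$; $t_{ij}$ arrows from $b_i$ to $b_j$ for each pair $i,j$; $t_{ij}$ arrows from $v_i$ to $b_j$ for each pair $i,j$ (the case $i=j$ is included, so loops may occur and count as oriented cycles). *)

(* Defs.v *)
From HB Require Import structures.
From mathcomp Require Import all_boot all_order all_algebra.
From mathcomp Require Import finmap.
From mathcomp Require Import boolp classical_sets functions cardinality.
From mathcomp.multinomials Require Import monalg.

Set Implicit Arguments.
Unset Strict Implicit.
Unset Printing Implicit Defensive.

Import GRing.Theory.
Local Open Scope ring_scope.
Local Open Scope quotient_scope.

Record quiver := Quiver {
  vertex : finType;
  arrow : finType;
  src : arrow -> vertex;
  tgt : arrow -> vertex }.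

Fixpoint is_walk (Q : quiver) (x : vertex Q) (s : seq (arrow Q)) : bool :=
  if s is a :: s' then (src a == x) && is_walk (tgt a) s' else true.

Definition walk_end (Q : quiver) (x : vertex Q) (s : seq (arrow Q)) : vertex Q :=
  last x [seq tgt a | a <- s].

(* A path is its starting vertex together with the arrows in the order in
   which they are traversed, so the path written a_r ... a_1 (composed right
   to left) is the list [:: a_1; ...; a_r]. *)
Record qpath (Q : quiver) := QPath {
  qpath_val : vertex Q * seq (arrow Q);
  _ : is_walk qpath_val.1 qpath_val.2 }.

HB.instance Definition _ (Q : quiver) := [isSub for @qpath_val Q].
HB.instance Definition _ (Q : quiver) := [Choice of qpath Q by <:].

Section Paths.
Variable Q : quiver.
Implicit Types (p q r : qpath Q) (x : vertex Q) (a : arrow Q).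

Definition psrc p : vertex Q := (qpath_val p).1.
Definition parrows p : seq (arrow Q) := (qpath_val p).2.
Definition ptgt p : vertex Q := walk_end (psrc p) (parrows p).
Definition plength p : nat := size (parrows p).

Definition idpath x : qpath Q := @QPath Q (x, [::]) isT.

Fact arrow_walk a : is_walk (src a) [:: a].
Proof. by rewrite /= eqxx. Qed.
Definition arrpath a : qpath Q := @QPath Q (src a, [:: a]) (arrow_walk a).

Lemma is_walk_cat x s1 s2 :
  is_walk x (s1 ++ s2) = is_walk x s1 && @is_walk Q (walk_end x s1) s2.
Proof. by elim: s1 x => //= a s1 IH x; rewrite IH andbA. Qed.

(* [pcomp q p] is the composite qp (first p, then q), when it exists. *)
Definition pcomp q p : option (qpath Q) :=
  if psrc q == ptgt p then insub (psrc p, parrows p ++ parrows q) else None.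

Definition acyclic : Prop :=
  forall p, (0 < plength p)%N -> psrc p <> ptgt p.

Definition max_path_length (l : nat) : Prop :=
  (exists p, plength p = l) /\ (forall p, (plength p <= l)%N).

Variant pcomp_spec q p : option (qpath Q) -> Prop :=
| PcompSome r of psrc q = ptgt p & psrc r = psrc p & ptgt r = ptgt q
    & parrows r = parrows p ++ parrows q : pcomp_spec q p (Some r)
| PcompNone of psrc q <> ptgt p : pcomp_spec q p None.

Lemma walk_end_cat x s1 s2 :
  walk_end x (s1 ++ s2) = @walk_end Q (walk_end x s1) s2.
Proof. by rewrite /walk_end map_cat last_cat. Qed.

Lemma pcompP q p : pcomp_spec q p (pcomp q p).
Proof.
rewrite /pcomp; case: eqP => [e|ne]; last by constructor.
case: insubP => [r _ er|].
  constructor; rewrite /ptgt /psrc /parrows ?er //=.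
  by rewrite walk_end_cat -/(psrc p) -/(parrows p) -/(ptgt p) -e.
rewrite /= is_walk_cat -/(ptgt p) -e.
by case: q p {e} => [[x s] /= ws] [[y t] /= wt]; rewrite /psrc /parrows /= wt ws.
Qed.

Lemma qpath_eqP p q : psrc p = psrc q -> parrows p = parrows q -> p = q.
Proof.
move=> e1 e2; apply/val_inj; rewrite /=.
move: e1 e2; rewrite /psrc /parrows.
by case: (qpath_val p) => x s; case: (qpath_val q) => y t /= -> ->.
Qed.

Lemma pcompA p q r :
  obind (fun s => pcomp s r) (pcomp p q) = obind (pcomp p) (pcomp q r).
Proof.
case: pcompP => [s e1 s1 s2 s3|ne1]; case: pcompP => [t f1 t1 t2 t3|ne2] //=.
- case: pcompP => [u g1 u1 u2 u3|]; last by rewrite s1 f1.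
  case: pcompP => [v h1 v1 v2 v3|]; last by rewrite t2 e1.
  by congr Some; apply: qpath_eqP; rewrite ?u1 ?v1 ?t1 // u3 v3 s3 t3 catA.
- by case: pcompP => // u g1; case: ne2; rewrite -g1 s1.
- by case: pcompP => // u g1; case: ne1; rewrite g1 t2.
Qed.

Lemma pcomp_idl x p : pcomp (idpath x) p = if x == ptgt p then Some p else None.
Proof.
case: pcompP => [r e r1 r2 r3|/eqP/negbTE]; last by rewrite /psrc /= => ->.
rewrite -e eqxx; congr Some; apply: qpath_eqP => //.
by rewrite r3 /= cats0.
Qed.

Lemma pcomp_idr x p : pcomp p (idpath x) = if x == psrc p then Some p else None.
Proof.
case: pcompP => [r e r1 r2 r3|/eqP/negbTE].
  move: e; rewrite /ptgt /= => e.
  by rewrite e eqxx; congr Some; apply: qpath_eqP; rewrite ?e ?r1 ?r3.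
by rewrite eq_sym /ptgt /= => ->.
Qed.

End Paths.

Definition pathalg (K : fieldType) (Q : quiver) : Type := {malg K[qpath Q]}.

HB.instance Definition _ (K : fieldType) (Q : quiver) :=
  GRing.Lmodule.on (pathalg K Q).

(* Bilinear extension of the composition of paths, non-composable paths
   having product 0. *)
Definition pa_term (K : fieldType) (Q : quiver) (c : K)
    (o : option (qpath Q)) : pathalg K Q :=
  if o is Some r then << c *g r >> else 0.

HB.lock Definition pa_mul (K : fieldType) (Q : quiver) (x y : pathalg K Q) :
    pathalg K Q :=
  \sum_(q <- msupp x) \sum_(p <- msupp y) pa_term (x@_q * y@_p) (pcomp q p).

Section PathAlgebra.
Variables (K : fieldType) (Q : quiver).
Local Notation A := (pathalg K Q).
Local Notation pa_mul := (@pa_mul K Q).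
Local Notation pa_term := (@pa_term K Q).
Implicit Types (x y z : A) (p q r : qpath Q) (c d : K).

Definition pa_one : A := \sum_(v : vertex Q) << idpath v >>.

Let pa_term0 o : pa_term 0 o = 0.
Proof. by case: o => //= r; exact: monalgU0. Qed.

Let pa_termD c d o : pa_term (c + d) o = pa_term c o + pa_term d o.
Proof. by case: o => [r|] /=; rewrite ?addr0 //; exact: monalgUD. Qed.

Let pa_mulw (d1 d2 : {fset qpath Q}) x y :
  (msupp x `<=` d1)%fset -> (msupp y `<=` d2)%fset ->
  pa_mul x y =
    \sum_(q <- d1) \sum_(p <- d2) pa_term (x@_q * y@_p) (pcomp q p).
Proof.
move=> le1 le2; rewrite pa_mul.unlock (big_fset_incl _ le1) /=; last first.
  by move=> q _ /mcoeff_outdom xq; rewrite big1 // => p _; rewrite xq mul0r.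
apply: eq_bigr => q _; apply: big_fset_incl => // p _ /mcoeff_outdom ->.
by rewrite mulr0.
Qed.

Let pa_mulDl : left_distributive pa_mul +%R.
Proof.
move=> x y z; pose D := (msupp x `|` msupp y)%fset.
have hz := fsubset_refl (msupp z).
rewrite (@pa_mulw D (msupp z) (x + y)) ?msuppD_le //.
rewrite (@pa_mulw D (msupp z) x) ?fsubsetUl //.
rewrite (@pa_mulw D (msupp z) y) ?fsubsetUr //.
rewrite -big_split; apply: eq_bigr => q _ /=.
rewrite -big_split; apply: eq_bigr => p _ /=.
by rewrite mcoeffD mulrDl pa_termD.
Qed.

Let pa_mulDr : right_distributive pa_mul +%R.
Proof.
move=> z x y; pose D := (msupp x `|` msupp y)%fset.
have hz := fsubset_refl (msupp z).
rewrite (@pa_mulw (msupp z) D z (x + y)) ?msuppD_le //.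
rewrite (@pa_mulw (msupp z) D z x) ?fsubsetUl //.
rewrite (@pa_mulw (msupp z) D z y) ?fsubsetUr //.
rewrite -big_split; apply: eq_bigr => q _ /=.
rewrite -big_split; apply: eq_bigr => p _ /=.
by rewrite mcoeffD mulrDr pa_termD.
Qed.

Let pa_mul0l x : pa_mul 0 x = 0.
Proof. by rewrite pa_mul.unlock msupp0 big_seq_fset0. Qed.

Let pa_mul0r x : pa_mul x 0 = 0.
Proof. by rewrite pa_mul.unlock big1 // => q _; rewrite msupp0 big_seq_fset0. Qed.

Lemma pa_mulUU c d q p :
  pa_mul << c *g q >> << d *g p >> = pa_term (c * d) (pcomp q p).
Proof.
by rewrite (pa_mulw msuppU_le msuppU_le) !big_seq_fset1 !mcoeffUU.
Qed.

Let pa_mul_suml I (s : seq I) (F : I -> A) y :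
  pa_mul (\sum_(i <- s) F i) y = \sum_(i <- s) pa_mul (F i) y.
Proof.
exact: (big_morph (pa_mul^~ y) (fun a b => pa_mulDl a b y) (pa_mul0l y)).
Qed.

Let pa_mul_sumr I (s : seq I) (F : I -> A) y :
  pa_mul y (\sum_(i <- s) F i) = \sum_(i <- s) pa_mul y (F i).
Proof.
exact: (big_morph (pa_mul y) (fun a b => pa_mulDr y a b) (pa_mul0r y)).
Qed.

Let pa_ind (P : A -> Prop) :
  P 0 -> (forall x y, P x -> P y -> P (x + y)) ->
  (forall c p, P << c *g p >>) -> forall x, P x.
Proof. by move=> P0 PD PU x; rewrite [x]monalgE; apply: big_ind. Qed.

Let pa_mulA : associative pa_mul.
Proof.
have ind := pa_ind; have mulUU := pa_mulUU.
move: mulUU ind pa_mulDl pa_mulDr pa_mul0l pa_mul0r; rewrite /pa_term.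
move: (@mkmalgU (qpath Q) K) (pa_mul) (0 : A) => U mul z0.
move=> mulUU ind mulDl mulDr mul0l mul0r x y z.
elim/ind: x => [|x x' IH IH'|c p].
- by rewrite !mul0l.
- by rewrite !mulDl IH IH'.
elim/ind: y => [|y y' IH IH'|d q].
- by rewrite mul0l !mul0r mul0l.
- by rewrite mulDl !mulDr mulDl IH IH'.
elim/ind: z => [|z z' IH IH'|e r].
- by rewrite !mul0r.
- by rewrite !mulDr IH IH'.
rewrite !mulUU; have := pcompA p q r.
case: (pcomp q r) => [t|]; case: (pcomp p q) => [s|] /=.
- by rewrite !mulUU => ->; rewrite mulrA.
- by rewrite mulUU mul0l => <-.
- by rewrite mulUU mul0r => ->.
- by rewrite mul0l mul0r.
Qed.

Let pa_mul1l : left_id pa_one pa_mul.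
Proof.
elim/pa_ind => [|x y IHx IHy|c p]; first exact: pa_mul0r.
  by rewrite pa_mulDr IHx IHy.
rewrite /pa_one pa_mul_suml (bigD1 (ptgt p)) //= pa_mulUU pcomp_idl eqxx mul1r.
rewrite big1 ?addr0 // => v /negbTE nv.
by rewrite pa_mulUU pcomp_idl nv.
Qed.

Let pa_mul1r : right_id pa_one pa_mul.
Proof.
elim/pa_ind => [|x y IHx IHy|c p]; first exact: pa_mul0l.
  by rewrite pa_mulDl IHx IHy.
rewrite /pa_one pa_mul_sumr (bigD1 (psrc p)) //= pa_mulUU pcomp_idr eqxx mulr1.
rewrite big1 ?addr0 // => v /negbTE nv.
by rewrite pa_mulUU pcomp_idr nv.
Qed.

HB.instance Definition _ :=
  GRing.Zmodule_isPzRing.Build A pa_mulA pa_mul1l pa_mul1r pa_mulDl pa_mulDr.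

Definition pa_arrow (a : arrow Q) : A := << arrpath a >>.

End PathAlgebra.

Definition two_sided_ideal (R : pzRingType) (J : set R) : Prop :=
  [/\ J 0, forall x y, J x -> J y -> J (x - y)
    & forall a x, J x -> J (a * x) /\ J (x * a)].

Definition ideal_gen (R : pzRingType) (S : set R) : {pred R} :=
  fun x => `[< forall J : set R, two_sided_ideal J -> (S `<=` J)%classic -> J x >].

Section QuotientRing.
Variables (R : pzRingType) (S : set R).

Fact ideal_gen_zmod_closed : zmod_closed (ideal_gen S).
Proof.
split=> [|x y /asboolP hx /asboolP hy]; apply/asboolP=> J iJ sJ.
  by case: iJ.
by case: (iJ) => _ h _; apply: h; [exact: hx|exact: hy].
Qed.

HB.instance Definition _ :=
  GRing.isZmodClosed.Build R (ideal_gen S) ideal_gen_zmod_closed.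

Lemma ideal_genMl a x : x \in ideal_gen S -> a * x \in ideal_gen S.
Proof.
move=> /asboolP hx; apply/asboolP=> J iJ sJ; case: (iJ) => _ _ h.
by case: (h a x (hx J iJ sJ)).
Qed.

Lemma ideal_genMr a x : x \in ideal_gen S -> x * a \in ideal_gen S.
Proof.
move=> /asboolP hx; apply/asboolP=> J iJ sJ; case: (iJ) => _ _ h.
by case: (h a x (hx J iJ sJ)).
Qed.

Definition quot_ring : Type := Quotient.quot (ideal_gen S).

HB.instance Definition _ := GRing.Zmodule.on quot_ring.
HB.instance Definition _ : ZmodQuotient R (Quotient.equiv (ideal_gen S))
  0 -%R +%R quot_ring := ZmodQuotient.on quot_ring.

Definition quot_one : quot_ring := lift_cst quot_ring 1.
Definition quot_mul := lift_op2 quot_ring *%R.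

Canonical pi_quot_one_morph := PiConst quot_one.

Lemma pi_quot_mul : {morph \pi : x y / x * y >-> quot_mul x y}.
Proof.
move=> x y; unlock quot_mul; apply/eqP; rewrite piE Quotient.equivE.
rewrite -[_ * _](addrNK (x * repr (\pi_quot_ring y))) -mulrBr -addrA -mulrBl.
rewrite rpredD //.
  by rewrite ideal_genMl // Quotient.idealrBE reprK.
by rewrite ideal_genMr // Quotient.idealrBE reprK.
Qed.
Canonical pi_quot_mul_morph := PiMorph2 pi_quot_mul.

Let quot_mulA : associative quot_mul.
Proof.
by move=> x y z; rewrite -[x]reprK -[y]reprK -[z]reprK !piE mulrA.
Qed.
Let quot_mul1l : left_id quot_one quot_mul.
Proof. by move=> x; rewrite -[x]reprK !piE mul1r. Qed.
Let quot_mul1r : right_id quot_one quot_mul.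
Proof. by move=> x; rewrite -[x]reprK !piE mulr1. Qed.
Let quot_mulDl : left_distributive quot_mul +%R.
Proof.
by move=> x y z; rewrite -[x]reprK -[y]reprK -[z]reprK !piE mulrDl.
Qed.
Let quot_mulDr : right_distributive quot_mul +%R.
Proof.
by move=> x y z; rewrite -[x]reprK -[y]reprK -[z]reprK !piE mulrDr.
Qed.

HB.instance Definition _ := GRing.Zmodule_isPzRing.Build quot_ring
  quot_mulA quot_mul1l quot_mul1r quot_mulDl quot_mulDr.

End QuotientRing.

(* Everything is stated for left modules. *)
Section GlobalDimension.
Variable R : pzRingType.

Definition projective (P : lmodType R) : Prop :=
  forall (M N : lmodType R) (f : {linear M -> N}) (g : {linear P -> N}),
    (forall y, exists x, f x = y) ->
    exists h : {linear P -> M}, forall x, f (h x) = g x.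

Record proj_resolution (M : lmodType R) := ProjResolution {
  res_mod : nat -> lmodType R;
  res_diff : forall i, {linear res_mod i.+1 -> res_mod i};
  res_aug : {linear res_mod 0%N -> M};
  res_proj : forall i, projective (res_mod i);
  res_aug_surj : forall y, exists x, res_aug x = y;
  res_exact0 : forall x, res_aug x = 0 <-> exists y, res_diff 0%N y = x;
  res_exact : forall i x,
    res_diff i x = 0 <-> exists y, res_diff i.+1 y = x }.

Definition proj_dim_le (M : lmodType R) (d : nat) : Prop :=
  exists res : proj_resolution M,
    forall i, (d < i)%N -> forall x : res_mod res i, x = 0.

Definition gl_dim_le (d : nat) : Prop :=
  forall M : lmodType R, proj_dim_le M d.

Definition finite_gl_dim : Prop := exists d, gl_dim_le d.

(* The supremum of the projective dimensions of all left modules is d. *)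
Definition gl_dim_eq (d : nat) : Prop :=
  gl_dim_le d /\ forall d', gl_dim_le d' -> (d <= d')%N.

End GlobalDimension.

(* The vertices 1 and 2 are [false] and [true]; [inl j] is c_j and [inr i]
   is b_i. *)
Definition quiverQ (n m : nat) : quiver :=
  @Quiver bool ('I_n + 'I_m)%type
    (fun a => if a is inl _ then false else true)
    (fun a => if a is inl _ then true else false).

Section Family.
Variables (K : fieldType) (n m : nat).
Variables V W : 'I_m -> {vspace 'rV[K]_n}.

Local Notation A := (pathalg K (quiverQ n m)).

(* The space C (resp. B) is identified with row vectors through its basis of
   arrows c_j (resp. b_i). *)
Definition elt_b (i : 'I_m) : A := @pa_arrow K (quiverQ n m) (inr i).
Definition elt_C (u : 'rV[K]_n) : A :=
  \sum_(j < n) u 0 j *: @pa_arrow K (quiverQ n m) (inl j).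
Definition elt_B (u : 'rV[K]_m) : A := \sum_(i < m) u 0 i *: elt_b i.

Inductive relF : A -> Prop :=
| relF_bcb b c b' : relF (elt_B b * elt_C c * elt_B b')
| relF_wb i w : w \in W i -> relF (elt_C w * elt_b i)
| relF_bv i v : v \in V i -> relF (elt_b i * elt_C v).

Definition algR : pzRingType := quot_ring (relF : set A).

Definition tdim (i j : 'I_m) : nat := \dim (V i :&: W j)%VS.

(* Vertices: [inl i] is b_i and [inr i] is v_i.  Arrows: first b_i -> v_i,
   then the t_ij arrows b_i -> b_j, then the t_ij arrows v_i -> b_j. *)
Definition tarrow : Type := {ij : 'I_m * 'I_m & 'I_(tdim ij.1 ij.2)}.
HB.instance Definition _ := Finite.on tarrow.

Definition quiverGamma : quiver :=
  @Quiver ('I_m + 'I_m)%type ('I_m + (tarrow + tarrow))%type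
    (fun a => match a with
              | inl i => inl i
              | inr (inl s) => inl (tag s).1
              | inr (inr s) => inr (tag s).1
              end)
    (fun a => match a with
              | inl i => inr i
              | inr (inl s) => inl (tag s).2
              | inr (inr s) => inl (tag s).2
              end).

End Family.

(* Main.v *)
Require Import Defs.
From HB Require Import structures.
From mathcomp Require Import all_boot all_order all_algebra.
From mathcomp Require Import finmap.
From mathcomp Require Import boolp classical_sets functions cardinality.
From mathcomp.multinomials Require Import monalg.

(* R has the k-basis e_1, e_2, C, B, (C/W_i) b_i, b_i (C/V_i),
   (C/W_i) b_i (C/V_i). Put M_i = R b_i and N_i = R W_i (inside R e_1). The
   minimal covers of the relevant modules by sums of R e_1 and R e_2 give
     Omega S_2 = sum of the M_i,     Omega^2 S_1 = sum of k copies of each M_i,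
     Omega M_i = N_i + t_ji M_j,     Omega N_i = sum of the t_ji M_j,
   where N_i <> 0, and M_i is never projective. Hence the projective dimension of
   M_i is 2 r + 1, with r the maximal number of edges of a chain i -> j -> ... of
   indices with t_ji > 0, and that of S_1 is the largest one, 2 r + 3. A longest
   path of Gamma runs b -> v along a longest chain of indices, so it has length
   l = 2 r + 1. Every left module has a filtration of length 4 with quotients
   sums of simple modules, which bounds the global dimension by that of S_1 and
   S_2. As the multiplicities may be infinite, the syzygies above are computed
   for the modules tensored with an arbitrary vector space X. *)

Set Implicit Arguments.
Unset Strict Implicit.
Unset Printing Implicit Defensive.
Import GRing.Theory.
Local Open Scope ring_scope.
Local Open Scope quotient_scope.

(** * Exact sequences and projective dimension *)

(** The multiplicity [t_ji] enters through the map from [W_i] to [C/V_j], a square matrix because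
    both spaces have dimension [n - k]. Its kernel is the intersection of [V_j] and [W_i], so its
    cokernel has dimension [t_ji] as well: the cokernel produces the copies of [M_j] in [Omega M_i],
    the kernel those in [Omega N_i]. If [t_ji = 0], the matrix is invertible and both vanish. If
    [t_ji > 0], one nonzero vector of the kernel suffices for the lower bound, since it makes [M_j]
    a direct summand of the kernel of the cover of [N_i]. So each edge of a chain costs two units of
    dimension, and its last index one more. The decompositions of the syzygies are never stated as
    isomorphisms: filtrations carry the upper bounds, retracts the lower ones. Lower bounds pass to
    kernels by Schanuel's lemma, which cannot tell a projective kernel from a zero one. The maxima
    with [1] in the statements record this loss, and the induction survives it because [M_i] is not
    projective. *)

Section LinearMaps.
Variable R : pzRingType.
Implicit Types M N P L : lmodType R.

Definition linof M N (f : M -> N) (Hf : linear f) : {linear M -> N} :=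
  HB.pack_for {linear M -> N} f (GRing.isLinear.Build R M N *:%R f Hf).

Lemma linofE M N (f : M -> N) (Hf : linear f) : linof Hf =1 f.
Proof. by []. Qed.

End LinearMaps.

Section Kernel.
Variables (R : pzRingType) (M N : lmodType R) (f : {linear M -> N}).

Definition in_ker : {pred M} := fun x => f x == 0.

Fact in_ker_submod : submod_closed in_ker.
Proof.
split=> [|a x y]; rewrite !unfold_in ?linear0 // => /eqP fx /eqP fy.
by rewrite linearP fx fy scaler0 addr0.
Qed.
HB.instance Definition _ := GRing.isSubmodClosed.Build R M in_ker in_ker_submod.

Record ker_mod := KerMod { ker_val : M; _ : ker_val \in in_ker }.
HB.instance Definition _ := [isSub for ker_val].
HB.instance Definition _ := [Choice of ker_mod by <:].
HB.instance Definition _ := [SubChoice_isSubLmodule of ker_mod by <:].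

End Kernel.

(** Locked, so that kernels are used only through [ker_inclP], [ker_inj], [ker_corestr] and
    [ker_lift]. *)
HB.lock Definition ker_incl (R : pzRingType) (M N : lmodType R)
    (f : {linear M -> N}) : {linear ker_mod f -> M} := val.

Section KernelTheory.
Variables (R : pzRingType) (M N : lmodType R) (f : {linear M -> N}).
Implicit Type L : lmodType R.

Lemma ker_inclP (x : ker_mod f) : f (ker_incl f x) = 0.
Proof. by rewrite ker_incl.unlock; apply/eqP; apply: (valP x). Qed.

Lemma ker_inj : injective (ker_incl f).
Proof. rewrite ker_incl.unlock; exact: val_inj. Qed.

Lemma ker_corestr L (g : {linear L -> M}) : (forall x, f (g x) = 0) ->
  exists h : {linear L -> ker_mod f}, forall x, ker_incl f (h x) = g x.
Proof.
move=> fg0.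
have Hk x : g x \in in_ker f by rewrite unfold_in fg0.
have Hl : linear (fun x => KerMod (Hk x)).
  by move=> a x y; apply: val_inj; rewrite /= linearP.
by exists (linof Hl) => x; rewrite ker_incl.unlock.
Qed.

Lemma ker_lift x : f x = 0 -> exists y, ker_incl f y = x.
Proof.
move=> /eqP fx; exists (KerMod (fx : x \in in_ker f)).
by rewrite ker_incl.unlock.
Qed.

End KernelTheory.

Section ExactSequences.
Variable R : pzRingType.
Implicit Types M N P L : lmodType R.

Definition onto (A B : Type) (f : A -> B) := forall y, exists x, f x = y.

Definition ses L M N (i : L -> M) (f : M -> N) :=
  [/\ injective i, onto f & forall x, f x = 0 <-> exists y, i y = x].

Lemma ses_ker M N (f : {linear M -> N}) : onto f -> ses (ker_incl f) f.
Proof.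
move=> fs; split=> //; first exact: ker_inj.
move=> x; split; first exact: ker_lift.
by move=> [y <-]; rewrite ker_inclP.
Qed.

Lemma linear_inj0 M N (f : {linear M -> N}) :
  (forall x, f x = 0 -> x = 0) -> injective f.
Proof.
by move=> f0 x y fxy; apply/subr0_eq/f0; rewrite linearB fxy subrr.
Qed.

Lemma linear_inverse M N (f : {linear M -> N}) : injective f -> onto f ->
  exists g : {linear N -> M}, cancel g f /\ cancel f g.
Proof.
move=> fi fs; have [g fg] := choice fs.
have gl : linear g.
  by move=> a x y; apply: fi; rewrite linearP !fg.
by exists (linof gl); split=> x; [exact: fg|apply: fi; exact: fg].
Qed.

Section Pairs.
Variables M N : lmodType R.
Fact pairl_linear : linear (fun x : M => (x, 0) : (M * N)%type).
Proof.
by move=> a x y; rewrite [RHS](_ : _ = (a *: x + y, a *: 0 + 0)) // scaler0 addr0.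
Qed.
Fact pairr_linear : linear (fun x : N => (0, x) : (M * N)%type).
Proof.
by move=> a x y; rewrite [RHS](_ : _ = (a *: 0 + 0, a *: x + y)) // scaler0 addr0.
Qed.
Fact fst_linear : linear (fst : (M * N)%type -> M). Proof. by []. Qed.
Fact snd_linear : linear (snd : (M * N)%type -> N). Proof. by []. Qed.
Definition pairl := linof pairl_linear.
Definition pairr := linof pairr_linear.
Definition pfst := linof fst_linear.
Definition psnd := linof snd_linear.
Variables M' N' : lmodType R.
Variables (f : {linear M -> M'}) (g : {linear N -> N'}).
Fact pair_map_linear : linear (fun x : (M * N)%type => (f x.1, g x.2) : (M' * N')%type).
Proof. by move=> a x y; rewrite /= !linearP. Qed.
Definition pair_map := linof pair_map_linear.
End Pairs.

End ExactSequences.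

Section Projective.
Variable R : pzRingType.
Implicit Types M N P Q L : lmodType R.

Lemma projective_split P M (f : {linear M -> P}) : projective P -> onto f ->
  exists s : {linear P -> M}, cancel s f.
Proof. by move=> pP fs; apply: (pP _ _ f idfun fs). Qed.

Lemma projective_retract P Q (i : {linear Q -> P}) (r : {linear P -> Q}) :
  cancel i r -> projective P -> projective Q.
Proof.
move=> ir pP M N f g fs; have [h hh] := pP _ _ f (g \o r) fs.
by exists (h \o i) => x; rewrite /= hh /= ir.
Qed.

Lemma projective0 P : (forall x : P, x = 0) -> projective P.
Proof.
move=> P0 M N f g fs; exists \0 => x.
by rewrite (P0 x) !linear0.
Qed.

Lemma projective_prod P Q : projective P -> projective Q ->
  projective (P * Q)%type.
Proof.
move=> pP pQ M N f g fs.
have [h hh] := pP _ _ f (g \o pairl P Q) fs.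
have [h' hh'] := pQ _ _ f (g \o pairr P Q) fs.
have l3 : linear (fun x : (P * Q)%type => h x.1 + h' x.2).
  by move=> a x y /=; rewrite !linearP scalerDr addrACA.
exists (linof l3) => -[x y] /=; rewrite linearD hh hh' /= -linearD /=.
by congr (g (_, _)); rewrite ?addr0 ?add0r.
Qed.

End Projective.

Section ProjectiveDimension.
Variable R : pzRingType.
Implicit Types M N P Q L : lmodType R.

(* [pdx d M] says that the projective dimension of [M] is less than [d], the
   zero module having dimension -oo. *)
Fixpoint pdx (d : nat) M : Prop :=
  if d is d'.+1 then
    exists P L (i : {linear L -> P}) (f : {linear P -> M}),
      [/\ projective P, ses i f & pdx d' L]
  else forall x : M, x = 0.

Lemma pdx_iso d M N (f : {linear M -> N}) :
  injective f -> onto f -> pdx d M -> pdx d N.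
Proof.
case: d => [|d] fi fs /=.
  by move=> M0 y; have [x <-] := fs y; rewrite (M0 x) linear0.
move=> [P [L [i [g [pP [ii gs ex] pL]]]]].
exists P, L, i, (f \o g); split=> //; split=> //.
  by move=> y; have [x <-] := fs y; have [z <-] := gs x; exists z.
move=> x; rewrite -ex /=; split; last by move=> ->; rewrite linear0.
by move=> fg0; apply: fi; rewrite fg0 linear0.
Qed.

(** Kernels are unique up to isomorphism, so an explicit model of a syzygy may replace
    [ker_mod f]. *)
Lemma pdx_ker d M N (f : {linear M -> N}) L (i : {linear L -> M}) :
  ses i f -> pdx d L <-> pdx d (ker_mod f).
Proof.
move=> [ii fs ex].
have [|h hh] := @ker_corestr _ _ _ f _ i; first by move=> x; apply/ex; exists x.
have hi : injective h by move=> x y xy; apply: ii; rewrite -!hh xy.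
have hs : onto h.
  move=> y; have /ex[x xy] := ker_inclP y.
  by exists x; apply: ker_inj; rewrite hh.
split; first exact: (pdx_iso hi hs).
have [g [gh hg]] := linear_inverse hi hs.
by apply: (pdx_iso (can_inj gh)) => x; exists (h x).
Qed.

Lemma pdx_cover d P M (f : {linear P -> M}) :
  projective P -> onto f -> pdx d (ker_mod f) -> pdx d.+1 M.
Proof.
by move=> pP fs pk; exists P, (ker_mod f), (ker_incl f), f; split=> //; apply: ses_ker.
Qed.

Lemma pdx_coverE d M : pdx d.+1 M ->
  exists P (f : {linear P -> M}), [/\ projective P, onto f & pdx d (ker_mod f)].
Proof.
move=> [P [L [i [f [pP sf pL]]]]]; exists P, f.
by split=> //; [case: sf|apply/(pdx_ker _ sf)].
Qed.

Lemma pdx0 d M : (forall x : M, x = 0) -> pdx d M.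
Proof.
elim: d M => // d IH M M0; apply: (@pdx_cover _ M M idfun).
- exact: projective0.
- by move=> x; exists x.
- by apply: IH => x; apply: ker_inj; rewrite (M0 (ker_incl _ x)) linear0.
Qed.

Lemma pdxS d M : pdx d M -> pdx d.+1 M.
Proof.
elim: d M => [|d IH] M; first exact: pdx0.
by move=> /pdx_coverE[P [f [pP fs /IH pk]]]; apply: pdx_cover pk.
Qed.

Lemma pdx_leq d d' M : (d <= d')%N -> pdx d M -> pdx d' M.
Proof.
by move=> /subnK <-; elim: (d' - d)%N => // e IH /IH; rewrite addSn; apply: pdxS.
Qed.

(** Horseshoe lemma: lifting the cover of [N] to [M] gives a cover of [M] by [P * Q], whose kernel
    is an extension of the kernels of the two covers. *)
Lemma pdx_ext d L M N (i : {linear L -> M}) (f : {linear M -> N}) :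
  ses i f -> pdx d L -> pdx d N -> pdx d M.
Proof.
elim: d L M N i f => [|d IH] L M N i f [ii fs ex].
  move=> /= L0 N0 x; have /ex[y <-] : f x = 0 by rewrite (N0 (f x)).
  by rewrite (L0 y) linear0.
move=> /pdx_coverE[P [p [pP ps pk]]] /pdx_coverE[Q [q [pQ qs qk]]].
have [s fsq] := pQ _ _ f q fs.
have l3 : linear (fun x : (P * Q)%type => i (p x.1) + s x.2).
  by move=> a x y /=; rewrite !linearP scalerDr addrACA.
pose g := linof l3.
have gE x y : g (x, y) = i (p x) + s y by [].
apply: (@pdx_cover _ _ _ g).
- exact: projective_prod.
- move=> m; have [y qy] := qs (f m).
  have /ex[l il] : f (m - s y) = 0 by rewrite linearB /= fsq qy subrr.
  by have [x px] := ps l; exists (x, y); rewrite gE px il subrK.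
have fip x : f (i x) = 0 by apply/ex; exists x.
have [|u uE] := @ker_corestr _ _ _ g _ (pairl P Q \o ker_incl p).
  by move=> x; rewrite [LHS](gE _ 0) ker_inclP !linear0 addr0.
have [|v vE] := @ker_corestr _ _ _ q _ (psnd P Q \o ker_incl g).
  move=> x; have := ker_inclP x; rewrite /=; case: (ker_incl g x) => [y z]; rewrite [LHS]gE /=.
  by rewrite -fsq; move=> /(congr1 f); rewrite linearD fip add0r linear0.
apply: (IH _ _ _ u v) pk qk; split.
- move=> x y /(congr1 (ker_incl g)); rewrite !uE => -[]; exact: ker_inj.
- move=> z; have /ex[l il] : f (s (ker_incl q z)) = 0 by rewrite fsq ker_inclP.
  have [x px] := ps l.
  have [|w wE] := @ker_lift _ _ _ g (- x, ker_incl q z).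
    by rewrite gE !linearN /= px il addNr.
  by exists w; apply: ker_inj; rewrite vE /= wE.
move=> w; split.
  move=> /(congr1 (ker_incl q)); rewrite vE linear0 /=.
  have := ker_inclP w; have wE : ker_incl g w = ker_incl g w by [].
  case: {2 3 4}(ker_incl g w) wE => [x y] wE; rewrite gE /= => + y0.
  rewrite y0 linear0 addr0 -(linear0 i) => /ii px.
  have [t tE] := ker_lift px; exists t; apply: ker_inj.
  by rewrite uE /= tE wE y0.
by move=> [x <-]; apply: ker_inj; rewrite vE /= uE /= linear0.
Qed.

Lemma pdx_proj d P : projective P -> pdx d.+1 P.
Proof.
move=> pP; apply: (@pdx_cover _ P P idfun) => //; first by move=> x; exists x.
by apply: pdx0 => x; apply: ker_inj; rewrite linear0; exact: (ker_inclP x).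
Qed.

Lemma pdx1_proj P : pdx 1 P -> projective P.
Proof.
move=> /pdx_coverE[Q [f [pQ fs k0]]].
have fi : injective f.
  apply: linear_inj0 => x fx; have [y <-] := ker_lift fx.
  by rewrite (k0 y) linear0.
have [g [gf fg]] := linear_inverse fi fs.
exact: projective_retract gf pQ.
Qed.

(** The cover [q] of [M] restricts to a cover of [ker f] by [ker (f \o q)]. The latter is a summand
    of [Q], because [f \o q] splits, and the restricted cover still has the kernel of [q]. *)
Lemma pdx_ker_proj d M P (f : {linear M -> P}) :
  projective P -> onto f -> pdx d M -> pdx d (ker_mod f).
Proof.
case: d => [|d] pP fs; first by move=> M0 x; apply: ker_inj; rewrite (M0 (ker_incl f x)) linear0.
move=> /pdx_coverE[Q [q [pQ qs pk]]].
have fqs : onto (f \o q).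
  by move=> y; have [x <-] := fs y; have [z <-] := qs x; exists z.
have [s fs'] := projective_split pP fqs.
have l : linear (fun x : Q => x - s (f (q x))).
  by move=> a x y; rewrite !linearP addrACA -scalerDr.
have [|r rE] := @ker_corestr _ _ _ (f \o q) _ (linof l).
  by move=> x /=; rewrite !linearB /= [f (q (s _))]fs' subrr.
have pK : projective (ker_mod (f \o q)).
  apply: (projective_retract (i := ker_incl _) (r := r)) pQ => x.
  apply: ker_inj; rewrite rE /=; have := ker_inclP x; rewrite /= => ->.
  by rewrite linear0 subr0.
have [|h hE] := @ker_corestr _ _ _ f _ (q \o ker_incl (f \o q)).
  by move=> x; rewrite -[RHS](ker_inclP x).
have hs : onto h.
  move=> y; have [x xE] := qs (ker_incl f y).
  have [|z zE] := @ker_lift _ _ _ (f \o q) x; first by rewrite /= xE ker_inclP.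
  by exists z; apply: ker_inj; rewrite hE /= zE.
apply: (pdx_cover pK hs).
have [|t tE] := @ker_corestr _ _ _ (f \o q) _ (ker_incl q).
  by move=> x; rewrite /= ker_inclP linear0.
have /pdx_ker <- // : ses t h.
split=> //; first by move=> x y /(congr1 (ker_incl _)); rewrite !tE; apply: ker_inj.
move=> x; split.
  move=> hx; have [|y yE] := @ker_lift _ _ _ q (ker_incl _ x).
    by have := hE x; rewrite hx linear0.
  by exists y; apply: ker_inj; rewrite tE.
by move=> [y <-]; apply: ker_inj; rewrite hE linear0 /= tE ker_inclP.
Qed.

(* Schanuel's lemma: the pullback of two covers maps onto each of them. The
   shift by two is needed since the cover need not be minimal: the kernel of a
   cover of a projective module is projective, but not zero. *)
Lemma pdx_kerE d P M (f : {linear P -> M}) :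
  projective P -> onto f -> pdx d.+2 M -> pdx d.+1 (ker_mod f).
Proof.
move=> pP fs /pdx_coverE[Q [q [pQ qs pk]]].
have l : linear (fun x : (P * Q)%type => f x.1 - q x.2).
  by move=> a x y /=; rewrite !linearP addrACA -scalerDr.
pose g := linof l; pose X := ker_mod g.
pose p1 : {linear X -> P} := pfst P Q \o ker_incl g.
pose p2 : {linear X -> Q} := psnd P Q \o ker_incl g.
have XE (x : X) : f (p1 x) = q (p2 x).
  by apply/subr0_eq; exact: (ker_inclP x).
have liftX x y : f x = q y -> exists z : X, ker_incl g z = (x, y).
  by move=> xy; apply: ker_lift; rewrite /g linofE /= xy subrr.
have [|i iE] := @ker_corestr _ _ _ g _ (pairl P Q \o ker_incl f).
  by move=> x /=; rewrite /= ker_inclP linear0 subr0.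
have [|j jE] := @ker_corestr _ _ _ g _ (pairr P Q \o ker_incl q).
  by move=> x /=; rewrite /= ker_inclP linear0 subr0.
have sj : ses j p1.
  split.
  - by move=> x y /(congr1 (ker_incl _)); rewrite !jE => -[]; apply: ker_inj.
  - move=> x; have [y qy] := qs (f x).
    by have [z zE] := liftX x y (esym qy); exists z; rewrite /p1 /= zE.
  - move=> x; split; last by move=> [y <-]; rewrite /p1 /= jE.
    move=> x0; have [|y yE] := @ker_lift _ _ _ q (p2 x).
      by rewrite -XE x0 linear0.
    exists y; apply: ker_inj; rewrite jE /= yE; move: x0; rewrite /p1 /p2 /=.
    by case: (ker_incl g x) => u v /= ->.
have si : ses i p2.
  split.
  - by move=> x y /(congr1 (ker_incl _)); rewrite !iE => -[]; apply: ker_inj.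
  - move=> y; have [x qy] := fs (q y).
    by have [z zE] := liftX x y qy; exists z; rewrite /p2 /= zE.
  - move=> x; split; last by move=> [y <-]; rewrite /p2 /= iE.
    move=> x0; have [|y yE] := @ker_lift _ _ _ f (p1 x).
      by rewrite XE x0 linear0.
    exists y; apply: ker_inj; rewrite iE /= yE; move: x0; rewrite /p1 /p2 /=.
    by case: (ker_incl g x) => u v /= ->.
have [_ p2s _] := si; apply/(pdx_ker _ si).
by apply: pdx_ker_proj => //; apply: (pdx_ext sj) => //; apply: pdx_proj.
Qed.

(* A retract [N] of [M] is covered by [P], like [M]; the kernel of that cover is
   a retract of the kernel of the cover of [M] by [P * P] built from the two
   complementary idempotents. *)
Lemma pdx_retract d M N (i : {linear N -> M}) (r : {linear M -> N}) :
  cancel i r -> pdx d M -> pdx d N.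
Proof.
elim: d M N i r => [|[_|d IH]] M N i r ir.
- by move=> M0 x; rewrite -(ir x) (M0 (i x)) linear0.
- move=> /pdx1_proj pM; apply: pdx_proj; exact: projective_retract ir pM.
move=> pM; have /pdx_coverE[P [f [pP fs _]]] := pM.
pose g : {linear (P * P)%type -> M} :=
  ((i \o (r \o f)) \o pfst P P) \+ ((f \- (i \o (r \o f))) \o psnd P P).
have gE x y : g (x, y) = i (r (f x)) + (f y - i (r (f y))) by [].
have gs : onto g.
  by move=> y; have [x <-] := fs y; exists (x, x); rewrite gE addrC subrK.
have pg := pdx_kerE (projective_prod pP pP) gs pM.
have rfs : onto (r \o f).
  by move=> y; have [x xE] := fs (i y); exists x; rewrite /= xE ir.
apply: (pdx_cover pP rfs).
have [|u uE] := @ker_corestr _ _ _ g _ (pairl P P \o ker_incl (r \o f)).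
  move=> x; rewrite [LHS]gE (ker_inclP x : r (f (ker_incl _ x)) = 0).
  by rewrite !linear0 !addr0.
have [|v vE] := @ker_corestr _ _ _ (r \o f) _ (pfst P P \o ker_incl g).
  move=> x; have := congr1 r (ker_inclP x); rewrite /=.
  case: (ker_incl g x) => [y z] /=.
  by rewrite !linearD linearN /= !ir subrr addr0 linear0.
apply: (IH _ _ u v) pg => x.
by apply: ker_inj; rewrite vE /= uE.
Qed.

(** The hypotheses say that [M / N] is the product of the [Q i], but only through the components
    [f i], so no product over [s] has to be built. The components are peeled off one at a time with
    [pdx_ext]. *)
Lemma pdx_filtration (I : eqType) (s : seq I) d M N (Q : I -> lmodType R)
    (f : forall i, {linear M -> Q i}) (j : {linear N -> M}) :
  uniq s -> injective j ->
  (forall x, (exists y, j y = x) <-> forall i, i \in s -> f i x = 0) ->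
  (forall i y, i \in s ->
     exists x, f i x = y /\ forall i', i' \in s -> i' != i -> f i' x = 0) ->
  pdx d N -> (forall i, i \in s -> pdx d (Q i)) -> pdx d M.
Proof.
elim: s M f j => [|a s IH] M f j.
  move=> _ ji jE _ pN _; apply: pdx_iso ji _ pN => x.
  by apply/jE.
move=> /andP[nas us] ji jE fE pN pQ.
have fs : onto (f a).
  by move=> y; have [x [<- _]] := fE a y (mem_head _ _); exists x.
apply: (pdx_ext (ses_ker fs)); last exact/pQ/mem_head.
have [|h hE] := @ker_corestr _ _ _ (f a) _ j.
  by move=> x; have /jE := ex_intro (fun y => j y = j x) x erefl; apply; apply: mem_head.
apply: (IH _ (fun i => f i \o ker_incl (f a)) h) => //.
- by move=> x y /(congr1 (ker_incl _)); rewrite !hE; apply: ji.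
- move=> x; split.
    move=> [y <-] i si /=; rewrite hE.
    by have /jE := ex_intro (fun z => j z = j y) y erefl; apply; rewrite in_cons si orbT.
  move=> H; have /jE[y yE] : forall i, i \in a :: s -> f i (ker_incl (f a) x) = 0.
    by move=> i; rewrite in_cons => /predU1P[->|/H//]; apply: ker_inclP.
  by exists y; apply: ker_inj; rewrite hE.
- move=> i y si; have [|x [xE x0]] := fE i y; first by rewrite in_cons si orbT.
  have [|z zE] := @ker_lift _ _ _ (f a) x.
    by apply: x0; [apply: mem_head|apply: contraNneq nas => ->].
  exists z; split=> [|i' si' ne]; rewrite /= zE //.
  by apply: x0 => //; rewrite in_cons si' orbT.
- by move=> i si; apply: pQ; rewrite in_cons si orbT.
Qed.

(** * From iterated covers to projective resolutions *)

Section Resolution.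
Variables (P M : lmodType R) (f : {linear P -> M}).
Hypotheses (pP : projective P) (fs : onto f).

Section Cons.
Variable r : proj_resolution (ker_mod f).

Let mod_ i : lmodType R := if i is j.+1 then res_mod r j else P.
Let diff_ i : {linear mod_ i.+1 -> mod_ i} :=
  match i with 0%N => ker_incl f \o res_aug r | j.+1 => res_diff r j end.

Definition cons_resolution : proj_resolution M.
Proof.
apply: (@ProjResolution _ _ mod_ diff_ f) => //.
- by case=> [|i]; [|apply: res_proj].
- move=> x; split=> [/ker_lift[y <-]|[y <-]]; last exact: ker_inclP.
  by have [z <-] := res_aug_surj r y; exists z.
- case=> [|i] x /=; last exact: res_exact.
  rewrite -res_exact0 -(linear0 (ker_incl f)).
  by split=> [/ker_inj|->].
Defined.

End Cons.

End Resolution.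

Lemma tail_resolution M (r : proj_resolution M) :
  exists r' : proj_resolution (ker_mod (res_aug r)),
    forall i, res_mod r' i = res_mod r i.+1.
Proof.
have [|h hE] := @ker_corestr _ _ _ (res_aug r) _ (res_diff r 0).
  by move=> x; apply/res_exact0; exists x.
unshelve eexists.
  apply: (@ProjResolution _ _ (fun i => res_mod r i.+1)
    (fun i => res_diff r i.+1) h).
  - by move=> i; apply: res_proj.
  - move=> y; have /res_exact0[x xE] := ker_inclP y.
    by exists x; apply: ker_inj; rewrite hE.
  - move=> x; rewrite -res_exact -hE -(linear0 (ker_incl (res_aug r))).
    by split=> [->|/ker_inj].
  - by move=> i x; apply: res_exact.
by [].
Qed.

Lemma pdx_resolution d M : pdx d M <->
  exists r : proj_resolution M, forall i, (d <= i)%N -> forall x : res_mod r i, x = 0.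
Proof.
split.
  elim: d M => [|d IH] M.
    move=> M0; unshelve eexists.
      apply: (@ProjResolution _ M (fun=> M) (fun=> \0) idfun).
      - by move=> i; apply: projective0.
      - by move=> y; exists y.
      - by move=> x; split=> [_|]; [exists 0; rewrite (M0 x)|rewrite (M0 x) linear0].
      - by move=> i x; split=> [_|]; [exists 0; rewrite (M0 x)|].
    by move=> i _ x; apply: M0.
  move=> /pdx_coverE[P [f [pP fs /IH[r rE]]]].
  exists (cons_resolution pP fs r) => -[//|i] /= di; exact: rE.
elim: d M => [|d IH] M [r r0].
  by move=> x; have [y <-] := res_aug_surj r x; rewrite (r0 0 _ y) ?linear0.
apply: (@pdx_cover _ (res_mod r 0) _ (res_aug r)).
- exact: res_proj.
- exact: res_aug_surj.
apply: IH; have [r' r'E] := tail_resolution r.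
by exists r' => i di; rewrite r'E; apply: r0.
Qed.

(** The shift arises because [gl_dim_le d] allows the terms in degrees [0] to [d], while [pdx d]
    bounds the number of terms. *)
Lemma gl_dim_le_pdx d : gl_dim_le R d <-> forall M, pdx d.+1 M.
Proof. by split=> H M; apply/pdx_resolution/H. Qed.

End ProjectiveDimension.

(** * Complements in vector spaces *)

Section VectorSpaces.
Variable K : fieldType.
Implicit Types X Y : lmodType K.

(* Zorn's lemma on the subspaces meeting [U] trivially. *)
Lemma complement X (U : X -> Prop) :
  U 0 -> (forall a x y, U x -> U y -> U (a *: x + y)) ->
  exists p : {linear X -> X}, (forall x, p (p x) = p x) /\ forall x, p x = 0 <-> U x.
Proof.
move=> U0 Ul.
pose P (A : set X) := (forall a x y, A x -> A y -> A (a *: x + y)) /\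
  forall x, A x -> U x -> x = 0.
have [F FP Ftot|A [[Al A0] Amax]] := @Zorn_bigcup X P.
  split=> [a x y [B FB Bx] [C FC Cy]|x [B FB Bx]]; last first.
    by have [_] := FP _ FB; apply.
  have [BC|CB] := Ftot _ _ FB FC.
    by exists C => //; have [h _] := FP _ FC; apply: h => //; apply: BC.
  by exists B => //; have [h _] := FP _ FB; apply: h => //; apply: CB.
(* The empty chain forces [P] to hold for the empty set, so [0] has to be obtained from
   maximality. *)
have A00 : A 0.
  apply: contrapT => nA0; apply: (Amax (A `|` [set 0])%classic).
    by split=> [|/(_ 0)]; [move=> x Ax; left|move=> h; apply/nA0/h; right].
  split=> [a x y|x].
    move=> [Ax|->] [Ay|->].
    - by left; apply: Al.
    - by case: nA0; have := Al (-1) x x Ax Ax; rewrite scaleN1r addNr.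
    - by left; rewrite scaler0 add0r.
    - by right; rewrite scaler0 addr0.
  by move=> [|//]; apply: A0.
have AZ a x : A x -> A (a *: x) by move=> Ax; rewrite -[_ *: _]addr0; apply: Al.
have AD x y : A x -> A y -> A (x + y) by move=> Ax; rewrite -[x]scale1r; apply: Al.
(* If [x] is not in [A + U], then [A + K x] still meets [U] trivially, against maximality. *)
have split_ex x : exists y, A y /\ U (x - y).
  apply: contrapT => nx.
  pose B := [set y | exists a z, A z /\ y = a *: x + z]%classic.
  apply: (Amax B).
    split=> [y Ay|h]; first by exists 0, y; rewrite scale0r add0r.
    apply: nx; exists x; rewrite subrr; split=> //; apply: (h x).
    by exists 1, 0; rewrite scale1r addr0.
  split=> [a _ _ [b [z [Az ->]]] [c [t [At ->]]]|_ [b [z [Az ->]]] fz].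
    exists (a * b + c), (a *: z + t); split; first exact: Al.
    by rewrite scalerDr scalerDl scalerA addrACA.
  have [b0|b0] := eqVneq b 0.
    by move: fz; rewrite b0 scale0r add0r; apply: A0.
  case: nx; exists (- b^-1 *: z); split; first exact: AZ.
  rewrite scaleNr opprK -[x](scalerK b0) -scalerDr -[_ *: _]addr0.
  exact: Ul.
have [p pE] := choice split_ex.
have uniqA x y z : A y -> A z -> U (x - y) -> U (x - z) -> y = z.
  move=> Ay Az fy fz; apply/eqP; rewrite -subr_eq0; apply/eqP/A0.
    by rewrite -scaleN1r addrC; apply: Al.
  have -> : y - z = (x - z) - (x - y) by rewrite opprB [RHS]addrC addrA subrK.
  by rewrite addrC -scaleN1r; apply: Ul.
have pl : linear p.
  move=> a x y; have [h1 h2] := pE x; have [h3 h4] := pE y.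
  have [h5 h6] := pE (a *: x + y).
  apply: uniqA h5 _ h6 _; first exact: Al.
  by rewrite opprD addrACA -scalerBr; apply: Ul.
exists (linof pl); split=> x; rewrite !linofE.
  have [h1 h2] := pE x; have [h3 h4] := pE (p x).
  by apply: uniqA h3 h1 h4 _; rewrite subrr.
have [h1 h2] := pE x; split=> [p0|fx0]; first by rewrite p0 subr0 in h2.
by apply: uniqA h1 A00 h2 _; rewrite subr0.
Qed.

(** The quotient is realised as a complement of [U]: the image of the idempotent [p], written as the
    kernel of [1 - p]. *)
Lemma quotient_space X (U : X -> Prop) :
  U 0 -> (forall a x y, U x -> U y -> U (a *: x + y)) ->
  exists (Y : lmodType K) (q : {linear X -> Y}), onto q /\ forall x, q x = 0 <-> U x.
Proof.
move=> U0 Ul; have [p [pp pE]] := complement U0 Ul.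
pose g : {linear X -> X} := idfun \- p.
have gE x : g x = x - p x by [].
have [|q qE] := @ker_corestr _ _ _ g _ p; first by move=> x; rewrite gE pp subrr.
exists (ker_mod g), q; split=> [y|x].
  exists (ker_incl g y); apply: ker_inj; rewrite qE; apply/eqP.
  by rewrite eq_sym -subr_eq0 -gE; apply/eqP/ker_inclP.
by rewrite -pE -qE -(linear0 (ker_incl g)); split=> [->|/ker_inj].
Qed.

Lemma linear_section X Y (f : {linear X -> Y}) : onto f ->
  exists s : {linear Y -> X}, cancel s f.
Proof.
move=> fs; have [||p [pp pE]] := @complement X (fun x => f x = 0).
- exact: linear0.
- by move=> a x y fx fy; rewrite linearP fx fy scaler0 addr0.
have [g gE] := choice fs.
(* [p] kills [ker f], so [p \o g] does not depend on the preimages chosen by [g]; hence it is linear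
   although [g] is not. *)
have pf x y : f x = f y -> p x = p y.
  move=> xy; apply/eqP; rewrite -subr_eq0 -linearB; apply/eqP/pE.
  by rewrite linearB xy subrr.
have sl : linear (p \o g).
  by move=> a x y /=; rewrite -linearP; apply: pf; rewrite linearP !gE.
exists (linof sl) => y; rewrite linofE /= -[RHS]gE; apply/eqP.
by rewrite -subr_eq0 -linearB; apply/eqP/pE; rewrite linearB pp subrr.
Qed.

Lemma vector_space_projective X : projective X.
Proof.
move=> M N f g fs; have [s fK] := linear_section fs.
by exists (s \o g) => x; rewrite /= fK.
Qed.

End VectorSpaces.

(** * Generators of the algebra *)

HB.lock Definition upath (K : fieldType) (Q : quiver) (c : K) (p : qpath Q) :
  pathalg K Q := << c *g p >>.

Section PathAlgebraTheory.
Variables (K : fieldType) (Q : quiver).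
Local Notation A := (pathalg K Q).
Local Notation upath := (@upath K Q).
Implicit Types (x y : A) (p q : qpath Q) (c d : K).

Lemma pathalg_mkE c p : << c *g p >> = upath c p :> A.
Proof. by rewrite upath.unlock. Qed.

Lemma upath_mul c d q p : upath c q * upath d p = pa_term (c * d) (Defs.pcomp q p).
Proof. by rewrite upath.unlock; exact: pa_mulUU. Qed.

Lemma upathZ c p : upath c p = c *: upath 1 p.
Proof.
rewrite upath.unlock; apply/malgP => q; rewrite [LHS]mcoeffU [RHS]mcoeffZ mcoeffU.
by case: (p == q); rewrite ?mulr1n ?mulr1 ?mulr0n ?mulr0.
Qed.

Lemma pathalg_ind (P : A -> Prop) :
  P 0 -> (forall x y, P x -> P y -> P (x + y)) ->
  (forall c p, P (upath c p)) -> forall x, P x.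
Proof. by move=> P0 PD PU x; rewrite [x]monalgE; apply: big_ind => // p _; rewrite pathalg_mkE; apply: PU. Qed.

Lemma pathalg_scaleE c d p : c *: upath d p = upath (c * d) p.
Proof. by rewrite upathZ scalerA -upathZ. Qed.

Lemma pathalg_scale_term c d o : c *: pa_term d o = pa_term (c * d) o :> A.
Proof. by case: o => [r|] /=; [rewrite !pathalg_mkE; exact: pathalg_scaleE|rewrite scaler0]. Qed.

Lemma pathalg_scaleAl c x y : c *: (x * y) = (c *: x) * y.
Proof.
elim/pathalg_ind: x => [|x x' IH IH'|d q].
- by rewrite scaler0 !mul0r scaler0.
- by rewrite scalerDr !mulrDl scalerDr IH IH'.
elim/pathalg_ind: y => [|y y' IH IH'|e p].
- by rewrite !mulr0 scaler0.
- by rewrite !mulrDr scalerDr IH IH'.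
by rewrite pathalg_scaleE !upath_mul pathalg_scale_term mulrA.
Qed.

Lemma pathalg_scaleAr c x y : c *: (x * y) = x * (c *: y).
Proof.
elim/pathalg_ind: x => [|x x' IH IH'|d q].
- by rewrite !mul0r scaler0.
- by rewrite !mulrDl scalerDr IH IH'.
elim/pathalg_ind: y => [|y y' IH IH'|e p].
- by rewrite !mulr0 !scaler0 mulr0.
- by rewrite scalerDr !mulrDr scalerDr IH IH'.
by rewrite pathalg_scaleE !upath_mul pathalg_scale_term mulrCA.
Qed.

Lemma pa_arrowE a : pa_arrow K a = upath 1 (arrpath a).
Proof. exact: pathalg_mkE. Qed.

Definition uvert (v : vertex Q) : A := upath 1 (idpath v).

Lemma pathalg_one : 1 = \sum_v uvert v :> A.
Proof. by rewrite /uvert upath.unlock. Qed.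

Lemma uvert_mul_path v c p :
  uvert v * upath c p = if v == ptgt p then upath c p else 0.
Proof. by rewrite upath_mul mul1r pcomp_idl; case: ifP; rewrite /= ?pathalg_mkE. Qed.

Lemma path_mul_uvert v c p :
  upath c p * uvert v = if v == psrc p then upath c p else 0.
Proof. by rewrite upath_mul mulr1 pcomp_idr; case: ifP; rewrite /= ?pathalg_mkE. Qed.

Lemma upath_cons (a : arrow Q) s (v : vertex Q) (w : is_walk v (a :: s)) (w' : is_walk (tgt a) s) :
  upath 1 (QPath (w : is_walk (v, a :: s).1 (v, a :: s).2)) =
  upath 1 (QPath (w' : is_walk (tgt a, s).1 (tgt a, s).2)) * pa_arrow K a.
Proof.
rewrite pa_arrowE upath_mul; case: pcompP => [r _ r1 _ r3|//].
rewrite mulr1 /pa_term pathalg_mkE; congr (upath _ _).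
apply: qpath_eqP; rewrite ?r1 ?r3 //.
by rewrite /psrc /=; case/andP: (w) => /eqP.
Qed.

End PathAlgebraTheory.

HB.lock Definition prj (K : fieldType) (n m : nat)
    (V W : 'I_m -> {vspace 'rV[K]_n})
    (x : pathalg K (quiverQ n m)) : algR V W := \pi_(quot_ring (relF V W)) x.

(** [algR] is declared only as a ring, so the [K]-structure is carried by these central elements. *)
HB.lock Definition kk (K : fieldType) (n m : nat)
    (V W : 'I_m -> {vspace 'rV[K]_n})
    (c : K) : algR V W := prj V W (c *: (1 : pathalg K (quiverQ n m))).
HB.lock Definition ee (K : fieldType) (n m : nat)
    (V W : 'I_m -> {vspace 'rV[K]_n})
    (v : bool) : algR V W := prj V W (uvert K (v : vertex (quiverQ n m))).
HB.lock Definition cc (K : fieldType) (n m : nat)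
    (V W : 'I_m -> {vspace 'rV[K]_n})
    (j : 'I_n) : algR V W := prj V W (pa_arrow K (inl j : arrow (quiverQ n m))).
HB.lock Definition bb (K : fieldType) (n m : nat)
    (V W : 'I_m -> {vspace 'rV[K]_n})
    (i : 'I_m) : algR V W := prj V W (pa_arrow K (inr i : arrow (quiverQ n m))).

Section Generators.
Variables (K : fieldType) (n m : nat) (V W : 'I_m -> {vspace 'rV[K]_n}).
Local Notation Q := (quiverQ n m).
Local Notation A := (pathalg K Q).
Local Notation R := (algR V W).
Local Notation prj := (prj V W).
Local Notation kk := (kk V W).
Local Notation ee := (ee V W).
Local Notation cc := (cc V W).
Local Notation bb := (bb V W).

Lemma prjD x y : prj (x + y) = prj x + prj y. Proof. by rewrite prj.unlock; exact: raddfD. Qed.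
Lemma prj0 : prj 0 = 0. Proof. by rewrite prj.unlock; exact: raddf0. Qed.
Lemma prjM x y : prj (x * y) = prj x * prj y. Proof. by rewrite prj.unlock; exact: pi_quot_mul. Qed.
Lemma prj1 : prj 1 = 1. Proof. by rewrite prj.unlock !piE. Qed.
Lemma prj_sum I (s : seq I) (F : I -> A) :
  prj (\sum_(i <- s) F i) = \sum_(i <- s) prj (F i).
Proof. by rewrite prj.unlock; exact: raddf_sum. Qed.

Lemma prj_onto r : exists x, prj x = r.
Proof. by exists (repr r); rewrite prj.unlock reprK. Qed.

Lemma prj_eqP x y : prj x = prj y <-> x - y \in ideal_gen (relF V W).
Proof. by rewrite prj.unlock Quotient.idealrBE; split=> [xy|/eqP//]; apply/eqP. Qed.

Lemma prj_rel x : relF V W x -> prj x = 0.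
Proof.
move=> xr; rewrite -prj0; apply/prj_eqP; rewrite subr0; apply/asboolP => J _; exact.
Qed.

Lemma prjZ c x : prj (c *: x) = kk c * prj x.
Proof. by rewrite kk.unlock -prjM -pathalg_scaleAl mul1r. Qed.

Lemma kkC c r : kk c * r = r * kk c.
Proof.
have [x <-] := prj_onto r.
by rewrite -prjZ kk.unlock -prjM -pathalg_scaleAr mulr1.
Qed.

Lemma kk1 : kk 1 = 1. Proof. by rewrite kk.unlock scale1r prj1. Qed.
Lemma kkD c d : kk (c + d) = kk c + kk d.
Proof. by rewrite kk.unlock scalerDl prjD. Qed.
Lemma kkM c d : kk (c * d) = kk c * kk d.
Proof.
have kkE e : kk e = prj (e *: (1 : A)) by rewrite kk.unlock.
by rewrite (kkE d) -prjZ scalerA -kkE.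
Qed.
Lemma kk0 : kk 0 = 0. Proof. by rewrite kk.unlock scale0r prj0. Qed.

Lemma eeD : ee false + ee true = 1.
Proof.
rewrite ee.unlock -prjD -prj1 pathalg_one; congr prj.
by rewrite -[RHS]/(\sum_(v : bool) uvert K (v : vertex Q)) big_bool addrC.
Qed.

Lemma ee_ee u v : ee u * ee v = if u == v then ee v else 0.
Proof. by rewrite ee.unlock -prjM ?pa_arrowE uvert_mul_path; case: ifP; rewrite ?prj0. Qed.
Lemma ee_cc v j : ee v * cc j = if v then cc j else 0.
Proof. by rewrite ee.unlock cc.unlock -prjM ?pa_arrowE uvert_mul_path; case: v; rewrite ?prj0. Qed.
Lemma cc_ee v j : cc j * ee v = if v then 0 else cc j.
Proof. by rewrite ee.unlock cc.unlock -prjM ?pa_arrowE path_mul_uvert; case: v; rewrite ?prj0. Qed.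
Lemma ee_bb v i : ee v * bb i = if v then 0 else bb i.
Proof. by rewrite ee.unlock bb.unlock -prjM ?pa_arrowE uvert_mul_path; case: v; rewrite ?prj0. Qed.
Lemma bb_ee v i : bb i * ee v = if v then bb i else 0.
Proof. by rewrite ee.unlock bb.unlock -prjM ?pa_arrowE path_mul_uvert; case: v; rewrite ?prj0. Qed.
Lemma cc_cc j j' : cc j * cc j' = 0.
Proof.
by have := ee_cc true j' => /= <-; rewrite mulrA cc_ee mul0r.
Qed.
Lemma bb_bb i i' : bb i * bb i' = 0.
Proof.
by have := ee_bb false i' => /= <-; rewrite mulrA bb_ee mul0r.
Qed.

Lemma elt_C_delta j : elt_C m (delta_mx 0 j : 'rV[K]_n) = @pa_arrow K Q (inl j).
Proof.
rewrite /elt_C (bigD1 j) //= big1 ?addr0 => [|i ij].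
  by rewrite mxE !eqxx scale1r.
by rewrite mxE (negbTE ij) andbF scale0r.
Qed.

Lemma elt_B_delta i : elt_B n (delta_mx 0 i : 'rV[K]_m) = @pa_arrow K Q (inr i).
Proof.
rewrite /elt_B (bigD1 i) //= big1 ?addr0 => [|j ij].
  by rewrite mxE !eqxx scale1r.
by rewrite mxE (negbTE ij) andbF scale0r.
Qed.

Lemma bb_cc_bb i j i' : bb i * cc j * bb i' = 0.
Proof.
rewrite cc.unlock bb.unlock -!prjM -elt_C_delta -!elt_B_delta; apply: prj_rel; exact: relF_bcb.
Qed.

Lemma prj_elt_C (u : 'rV[K]_n) : prj (elt_C m u) = \sum_j kk (u 0 j) * cc j.
Proof. by rewrite prj_sum cc.unlock; apply: eq_bigr => j _; rewrite prjZ. Qed.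

Lemma cc_bb_rel i (w : 'rV[K]_n) : w \in W i ->
  (\sum_j kk (w 0 j) * cc j) * bb i = 0.
Proof. by move=> wW; rewrite -prj_elt_C bb.unlock -prjM; apply/prj_rel/relF_wb. Qed.

Lemma bb_cc_rel i (v : 'rV[K]_n) : v \in V i ->
  bb i * (\sum_j kk (v 0 j) * cc j) = 0.
Proof. by move=> vV; rewrite -prj_elt_C bb.unlock -prjM; apply/prj_rel/relF_bv. Qed.

Lemma algR_ind (P : R -> Prop) :
  (forall r s, P r -> P s -> P (r + s)) -> (forall r s, P r -> P s -> P (r * s)) ->
  (forall c, P (kk c)) -> (forall v, P (ee v)) -> (forall j, P (cc j)) ->
  (forall i, P (bb i)) -> forall r, P r.
Proof.
move=> PD PM Pk Pe Pc Pb r; have [x <-] := prj_onto r.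
elim/pathalg_ind: x => [|x y|c [[x s] w]].
- by rewrite prj0 -kk0.
- by rewrite prjD; apply: PD.
rewrite upathZ prjZ; apply: (PM) => //.
elim: s x w => [|a s IH] x w.
  by have := Pe x; rewrite ee.unlock; congr (P (prj (upath _ _))); apply: qpath_eqP.
have w' : is_walk (tgt a) s by case/andP: (w).
rewrite (upath_cons K (w : is_walk x (a :: s)) w') prjM; apply: (PM); first exact: IH.
by case: a {w w'} => i; [have := Pc i|have := Pb i]; rewrite ?cc.unlock ?bb.unlock.
Qed.

End Generators.

(** * Modules defined by representations *)

Section PathAction.
Variables (K : fieldType) (Q : quiver) (U : lmodType K).
Variable op : qpath Q -> U -> U.
Hypothesis op_linear : forall p, linear (op p).
Hypothesis op_comp : forall q p u,
  op q (op p u) = if Defs.pcomp q p is Some r then op r u else 0.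
Local Notation A := (pathalg K Q).

Definition path_act (x : A) (u : U) : U := \sum_(p <- msupp x) x@_p *: op p u.

Lemma path_act_supp (d : {fset qpath Q}) x u : (msupp x `<=` d)%fset ->
  path_act x u = \sum_(p <- d) x@_p *: op p u.
Proof.
move=> xd; apply: big_fset_incl => // p _ /mcoeff_outdom ->.
by rewrite scale0r.
Qed.

Lemma path_actD x y u : path_act (x + y) u = path_act x u + path_act y u.
Proof.
rewrite (@path_act_supp (msupp x `|` msupp y)%fset (x + y)) ?msuppD_le //.
rewrite (@path_act_supp (msupp x `|` msupp y)%fset x) ?fsubsetUl //.
rewrite (@path_act_supp (msupp x `|` msupp y)%fset y) ?fsubsetUr //.
by rewrite -big_split; apply: eq_bigr => p _; rewrite mcoeffD scalerDl.
Qed.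

Lemma path_act0 u : path_act 0 u = 0.
Proof. by rewrite /path_act msupp0 big_seq_fset0. Qed.

Fact path_act_linear x : linear (path_act x).
Proof.
move=> c u u'; rewrite /path_act scaler_sumr -big_split; apply: eq_bigr => p _ /=.
by rewrite op_linear scalerDr !scalerA mulrC.
Qed.

Lemma path_act_upath c p u : path_act (upath c p) u = c *: op p u.
Proof. by rewrite upath.unlock (path_act_supp _ msuppU_le) big_seq_fset1 mcoeffUU. Qed.

Lemma path_act_term c o u :
  path_act (pa_term c o) u = if o is Some r then c *: op r u else 0.
Proof. by case: o => [r|]; [rewrite /= pathalg_mkE; exact: path_act_upath|exact: path_act0]. Qed.

Lemma path_actr0 x : path_act x 0 = 0.
Proof. exact: (linear0 (linof (path_act_linear x))). Qed.
Lemma path_actrD x u u' : path_act x (u + u') = path_act x u + path_act x u'.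
Proof. exact: (linearD (linof (path_act_linear x))). Qed.
Lemma path_actM x y u : path_act (x * y) u = path_act x (path_act y u).
Proof.
elim/pathalg_ind: x => [|x x' IH IH'|c q].
- by rewrite mul0r !path_act0.
- by rewrite mulrDl !path_actD IH IH'.
elim/pathalg_ind: y => [|y y' IH IH'|d p].
- by rewrite mulr0 !path_act0 path_actr0.
- by rewrite mulrDr !path_actD path_actrD IH IH'.
rewrite upath_mul path_act_term !path_act_upath.
have -> : op q (d *: op p u) = d *: op q (op p u).
  exact: (linearZZ (linof (@op_linear q))).
rewrite op_comp; case: (Defs.pcomp q p) => [r|]; first by rewrite scalerA.
by rewrite !scaler0.
Qed.

Lemma path_actZ c x u : path_act (c *: x) u = c *: path_act x u.
Proof.
elim/pathalg_ind: x => [|x x' IH IH'|d p].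
- by rewrite scaler0 path_act0 scaler0.
- by rewrite scalerDr [LHS]path_actD [in RHS]path_actD scalerDr; congr (_ + _).
by rewrite pathalg_scaleE (path_act_upath (c * d)) (path_act_upath d) scalerA.
Qed.

Lemma path_act_sum I (s : seq I) (F : I -> A) u :
  path_act (\sum_(i <- s) F i) u = \sum_(i <- s) path_act (F i) u.
Proof.
exact: (big_morph (path_act^~ u) (fun x y => path_actD x y u) (path_act0 u)).
Qed.

End PathAction.

Lemma pair_sum (U1 U2 : nmodType) I (s : seq I) (F : I -> (U1 * U2)%type) :
  \sum_(i <- s) F i = (\sum_(i <- s) (F i).1, \sum_(i <- s) (F i).2).
Proof.
by elim/big_rec3: _ => [//|i x y z _ ->]; case: (F i).
Qed.

Section Representations.
Variables (K : fieldType) (n m : nat) (V W : 'I_m -> {vspace 'rV[K]_n}).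
Local Notation Q := (quiverQ n m).
Local Notation A := (pathalg K Q).
Local Notation R := (algR V W).

Record rep := Rep {
  rep1 : lmodType K;
  rep2 : lmodType K;
  rep_c : 'I_n -> {linear rep1 -> rep2};
  rep_b : 'I_m -> {linear rep2 -> rep1};
  rep_bcb : forall i j i' u, rep_b i (rep_c j (rep_b i' u)) = 0;
  rep_wb : forall i w u, w \in W i ->
    \sum_j w 0 j *: rep_c j (rep_b i u) = 0;
  rep_bv : forall i v u, v \in V i ->
    rep_b i (\sum_j v 0 j *: rep_c j u) = 0 }.

Section Action.
Variable rho : rep.
Local Notation U := (rep1 rho * rep2 rho)%type.

Definition rep_arrow (a : arrow Q) (u : U) : U :=
  match a with inl j => (0, rep_c rho j u.1) | inr i => (rep_b rho i u.2, 0) end.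

Definition rep_vertex (v : vertex Q) (u : U) : U :=
  if (v : bool) then (0, u.2) else (u.1, 0).

Fact rep_arrow_linear a : linear (rep_arrow a).
Proof.
move=> c u u'; case: a => i /=.
  by rewrite linearP [RHS](_ : _ = (c *: 0 + 0, c *: rep_c rho i u.1 + rep_c rho i u'.1)) // scaler0 addr0.
by rewrite linearP [RHS](_ : _ = (c *: rep_b rho i u.2 + rep_b rho i u'.2, c *: 0 + 0)) // scaler0 addr0.
Qed.
Fact rep_vertex_linear v : linear (rep_vertex v).
Proof.
move=> c u u'; case: v => /=; rewrite /rep_vertex.
  by rewrite [RHS](_ : _ = (c *: 0 + 0, c *: u.2 + u'.2)) // scaler0 addr0.
by rewrite [RHS](_ : _ = (c *: u.1 + u'.1, c *: 0 + 0)) // scaler0 addr0.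
Qed.

(** Starting from [rep_vertex] makes a trivial path act as its idempotent rather than as the
    identity, which [rep_path_comp] needs. *)
Definition rep_path (p : qpath Q) (u : U) : U :=
  foldl (fun x a => rep_arrow a x) (rep_vertex (psrc p) u) (parrows p).

Fact foldl_linear s : linear (fun u : U => foldl (fun x a => rep_arrow a x) u s).
Proof.
elim: s => //= a s IH c u u'; by rewrite rep_arrow_linear IH.
Qed.

Fact rep_path_linear p : linear (rep_path p).
Proof. by move=> c u u'; rewrite /rep_path rep_vertex_linear foldl_linear. Qed.

Lemma rep_path_tgt p v u :
  rep_vertex v (rep_path p u) = if v == ptgt p then rep_path p u else 0.
Proof.
rewrite /rep_path /ptgt; case: p => -[x s] w; rewrite /psrc /parrows /= {w}.
elim/last_ind: s => [|s a _]; rewrite /walk_end /=.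
  by case: v; case: x.
rewrite foldl_rcons map_rcons last_rcons.
by case: a => j; case: v.
Qed.

Lemma rep_path_comp q p u :
  rep_path q (rep_path p u) = if Defs.pcomp q p is Some r then rep_path r u else 0.
Proof.
case: pcompP => [r e r1 r2 r3|ne].
  rewrite {1}/rep_path e rep_path_tgt eqxx /rep_path r3 foldl_cat r1.
  by [].
rewrite {1}/rep_path rep_path_tgt (negbTE (introN eqP ne)).
exact: (linear0 (linof (foldl_linear _))).
Qed.

Local Notation rep_act := (path_act rep_path).

Let rep_actD := path_actD rep_path.
Let rep_act0 := path_act0 rep_path.
Let rep_actZ := path_actZ rep_path.
Let rep_act_sum := path_act_sum rep_path.
Let rep_actr0 := path_actr0 rep_path_linear.
Let rep_actrD := path_actrD rep_path_linear.
Let rep_actM := path_actM rep_path_linear rep_path_comp.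

Lemma rep_act_uvert (v : vertex Q) u : rep_act (uvert K v) u = rep_vertex v u.
Proof. by rewrite path_act_upath scale1r. Qed.

Lemma rep_act1 u : rep_act 1 u = u.
Proof.
rewrite pathalg_one big_bool rep_actD !rep_act_uvert /rep_vertex /=.
by case: u => u1 u2; congr pair; rewrite /= ?add0r ?addr0.
Qed.

Lemma rep_act_arrow a u : rep_act (pa_arrow K a) u = rep_arrow a u.
Proof.
rewrite pa_arrowE path_act_upath scale1r /rep_path /=.
by case: a => j; case: u.
Qed.

Lemma rep_act_elt_C (w : 'rV[K]_n) u :
  rep_act (elt_C m w) u = (0, \sum_j w 0 j *: rep_c rho j u.1).
Proof.
rewrite rep_act_sum pair_sum; congr pair.
  rewrite big1 // => j _; rewrite rep_actZ rep_act_arrow /=; exact: scaler0.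
by apply: eq_bigr => j _; rewrite rep_actZ rep_act_arrow.
Qed.

Lemma rep_act_elt_B (w : 'rV[K]_m) u :
  rep_act (elt_B n w) u = (\sum_i w 0 i *: rep_b rho i u.2, 0).
Proof.
rewrite rep_act_sum pair_sum; congr pair.
  by apply: eq_bigr => j _; rewrite rep_actZ rep_act_arrow.
rewrite big1 // => j _; rewrite rep_actZ rep_act_arrow /=; exact: scaler0.
Qed.

Lemma rep_act_rel x u : relF V W x -> rep_act x u = 0.
Proof.
case=> [b c b'|i w wW|i v vV]; rewrite ?rep_actM ?rep_act_elt_B ?rep_act_elt_C /=.
- congr pair; rewrite big1 // => i _.
  rewrite linear_sum big1 ?scaler0 // => j _; rewrite linearZ /=.
  rewrite !linear_sum big1 ?scaler0 // => i' _.
  by rewrite !linearZ /= rep_bcb !scaler0.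
- by rewrite rep_act_arrow /= rep_wb.
- by rewrite rep_act_arrow /= rep_bv.
Qed.

(** The elements acting by zero form a two-sided ideal containing the relations. This makes the
    action through the representative [repr r] independent of its choice. *)
Lemma rep_act_ideal x u : x \in ideal_gen (relF V W) -> rep_act x u = 0.
Proof.
move=> /asboolP xI; move: u.
apply: (xI [set x | forall u, rep_act x u = 0]%classic); last first.
  by move=> y ry u; apply: rep_act_rel.
split=> /= [|y z hy hz|a y hy]; first exact: rep_act0.
  move=> u; rewrite -scaleN1r rep_actD rep_actZ hy hz scaler0; exact: addr0.
by split=> u; rewrite rep_actM ?hy ?rep_actr0.
Qed.

Definition rep_mod : Type := U.
HB.instance Definition _ := GRing.Zmodule.on rep_mod.

Definition rep_scale (r : R) (u : rep_mod) : rep_mod := rep_act (repr r) u.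

Lemma rep_scaleE x u : rep_scale (prj V W x) u = rep_act x u.
Proof.
rewrite /rep_scale; set y := repr _.
have /prj_eqP yx : prj V W y = prj V W x by rewrite /y prj.unlock reprK.
rewrite -[y](subrK x) rep_actD rep_act_ideal //; exact: add0r.
Qed.

Fact rep_scaleA r s u : rep_scale r (rep_scale s u) = rep_scale (r * s) u.
Proof.
have [x <-] := prj_onto r; have [y <-] := prj_onto s.
by rewrite -prjM !rep_scaleE rep_actM.
Qed.
Fact rep_scale1 : left_id 1 rep_scale.
Proof. by move=> u; rewrite -prj1 rep_scaleE rep_act1. Qed.
Fact rep_scaleDr : right_distributive rep_scale +%R.
Proof. by move=> r u u'; apply: rep_actrD. Qed.
Fact rep_scaleDl u : {morph rep_scale^~ u : r s / r + s}.
Proof.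
move=> r s; have [x <-] := prj_onto r; have [y <-] := prj_onto s.
by rewrite -prjD !rep_scaleE rep_actD.
Qed.
HB.instance Definition _ := GRing.Zmodule_isLmodule.Build R rep_mod
  rep_scaleA rep_scale1 rep_scaleDr rep_scaleDl.

(** A cast: it marks a pair as an element of the [R]-module, whose underlying type is the plain
    product. *)
Definition rep_in (u : U) : rep_mod := u.

Lemma rep_kk c u1 u2 : kk V W c *: rep_in (u1, u2) = rep_in (c *: u1, c *: u2).
Proof. by rewrite kk.unlock [LHS]rep_scaleE rep_actZ rep_act1. Qed.
Lemma rep_ee v u1 u2 :
  ee V W v *: rep_in (u1, u2) = rep_in (if v then (0, u2) else (u1, 0)).
Proof. by rewrite ee.unlock [LHS]rep_scaleE rep_act_uvert. Qed.
Lemma rep_cc j u1 u2 : cc V W j *: rep_in (u1, u2) = rep_in (0, rep_c rho j u1).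
Proof. by rewrite cc.unlock [LHS]rep_scaleE rep_act_arrow. Qed.
Lemma rep_bb i u1 u2 : bb V W i *: rep_in (u1, u2) = rep_in (rep_b rho i u2, 0).
Proof. by rewrite bb.unlock [LHS]rep_scaleE rep_act_arrow. Qed.

End Action.

Fact linear_on_generators (M N : lmodType R) (f : M -> N) :
  {morph f : x y / x + y} ->
  (forall c, {morph f : x / kk V W c *: x}) ->
  (forall v, {morph f : x / ee V W v *: x}) ->
  (forall j, {morph f : x / cc V W j *: x}) ->
  (forall i, {morph f : x / bb V W i *: x}) -> linear f.
Proof.
move=> fD fk fe fc fb r x y; rewrite fD; congr (_ + _).
elim/algR_ind: r x => [r s hr hs|r s hr hs|c|v|j|i] x.
- by rewrite !scalerDl fD hr hs.
- by rewrite -!scalerA hr hs.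
- exact: fk.
- exact: fe.
- exact: fc.
- exact: fb.
Qed.

End Representations.

(** * Matrices acting on vector-valued rows *)

Section Frames.
Variables (K : fieldType) (n : nat).

(* Mutually inverse splittings of [0 -> U -> K^n -> K^n/U -> 0]. *)
Record frame (U : {vspace 'rV[K]_n}) (p q : nat) := Frame {
  fr_in : 'M[K]_(p, n);
  fr_ret : 'M[K]_(n, p);
  fr_out : 'M[K]_(n, q);
  fr_sec : 'M[K]_(q, n);
  fr_inK : fr_in *m fr_ret = 1%:M;
  fr_secK : fr_sec *m fr_out = 1%:M;
  fr_in_out : fr_in *m fr_out = 0;
  fr_split : fr_ret *m fr_in + fr_out *m fr_sec = 1%:M;
  fr_mem : forall u, (u \in U) = (u *m fr_out == 0) }.

End Frames.

Lemma frame_exists (K : fieldType) n p q (U : {vspace 'rV[K]_n}) :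
  \dim U = p -> (p + q)%N = n -> inhabited (frame U p q).
Proof.
move=> dU pq; subst p; set p := \dim U in pq *.
pose B : 'M[K]_(p, n) := \matrix_(i < p) (vbasis U)`_i.
have Bu u : (u \in U) = (u <= B)%MS.
  rewrite -[U in LHS](span_basis (vbasisP U)); apply/idP/idP.
    move=> /coord_span ->; apply: summx_sub => i _; apply: scalemx_sub.
    by have := row_sub i B; rewrite rowK.
  move=> /submxP[v ->]; rewrite mulmx_sum_row; apply: memv_suml => i _.
  rewrite rowK; apply/memvZ/memv_span/mem_nth; by rewrite size_tuple.
have rB : row_free B.
  apply: inj_row_free => v; rewrite mulmx_sum_row => vB.
  have /freeP/(_ (v 0)) h := basis_free (vbasisP U).
  apply/rowP => i; rewrite mxE h // -[RHS]vB; apply: eq_bigr => j _.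
  by rewrite rowK.
move: (B) Bu rB => {}B; clearbody p; case: n / pq U B => U B Bu rB.
have := mulmx_ebase B; rewrite (eqP rB : \rank B = p) => BE.
set M := row_ebase B in BE; set L := col_ebase B in BE.
have Mu : M \in unitmx by exact: row_ebase_unit.
have Lu : L \in unitmx by exact: col_ebase_unit.
(* The first rows of [M] span [U], up to the change of basis [L], and the others complete them to a
   basis. The blocks of [M N = 1] and [N M = 1] are the identities of a frame. *)
pose N := invmx M.
have MN : M *m N = 1%:M by rewrite mulmxV.
have NM : N *m M = 1%:M by rewrite mulVmx.
move: (MN); rewrite -[M]vsubmxK -[N]hsubmxK mul_col_row scalar_mx_block.
move=> /eq_block_mx[h1 h2 h3 h4].
move: (NM); rewrite -[M]vsubmxK -[N]hsubmxK mul_row_col => h5.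
have inE : B = L *m usubmx M.
  rewrite -{1}BE -mulmxA; congr (_ *m _).
  by rewrite -[M in LHS]vsubmxK pid_mx_row mul_row_col mul1mx mul0mx addr0.
constructor; apply: (Frame h1 h4 h2 h5) => u; rewrite Bu.
apply/submxP/eqP => [[v ->]|u0].
  by rewrite inE -!mulmxA h2 !mulmx0.
exists (u *m lsubmx N *m invmx L).
rewrite {1}inE mulmxA mulmxKV //.
by rewrite -[LHS]mulmx1 -h5 mulmxDr !mulmxA u0 mul0mx addr0.
Qed.

Section MatrixAction.
Variable K : fieldType.
Implicit Types X Y : lmodType K.

Definition mxact a b (B : 'M[K]_(a, b)) X (y : {ffun 'I_a -> X}) : {ffun 'I_b -> X} :=
  [ffun t => \sum_j B j t *: y j].

Fact mxact_linear a b (B : 'M[K]_(a, b)) X : linear (@mxact a b B X).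
Proof.
move=> c y y'; apply/ffunP => t; rewrite !ffunE scaler_sumr -big_split.
by apply: eq_bigr => j _; rewrite !ffunE scalerDr !scalerA mulrC.
Qed.
HB.instance Definition _ a b B X :=
  GRing.isLinear.Build K _ _ _ (@mxact a b B X) (@mxact_linear a b B X).

Lemma mxactM a b c (B : 'M[K]_(a, b)) (C : 'M[K]_(b, c)) X (y : {ffun 'I_a -> X}) :
  mxact C (mxact B y) = mxact (B *m C) y.
Proof.
apply/ffunP => t; rewrite !ffunE.
under eq_bigr do rewrite ffunE scaler_sumr.
rewrite exchange_big; apply: eq_bigr => j _.
by rewrite mxE scaler_suml; apply: eq_bigr => s _; rewrite scalerA mulrC.
Qed.

Lemma mxact1 a X (y : {ffun 'I_a -> X}) : mxact 1%:M y = y.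
Proof.
apply/ffunP => t; rewrite ffunE (bigD1 t) //= mxE eqxx scale1r big1 ?addr0 // => j jt.
by rewrite mxE (negbTE jt) scale0r.
Qed.

Lemma mxact0 a b X (y : {ffun 'I_a -> X}) : mxact (0 : 'M[K]_(a, b)) y = 0.
Proof.
by apply/ffunP => t; rewrite !ffunE big1 // => j _; rewrite mxE scale0r.
Qed.

Lemma mxactDl a b (B C : 'M[K]_(a, b)) X (y : {ffun 'I_a -> X}) :
  mxact (B + C) y = mxact B y + mxact C y.
Proof.
apply/ffunP => t; rewrite !ffunE -big_split; apply: eq_bigr => j _ /=.
by rewrite mxE scalerDl.
Qed.

(* [{ffun 'I_a -> X}] stands for [K^a (x) X], on which matrices act from the
   right by [mxact]; [tensor w y] is the pure tensor [w (x) y]. *)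
Definition tensor a (w : 'rV[K]_a) X (y : X) : {ffun 'I_a -> X} :=
  [ffun t => w 0 t *: y].

Fact tensor_linear a (w : 'rV[K]_a) X : linear (@tensor a w X).
Proof.
move=> c y y'; apply/ffunP => t; rewrite !ffunE scalerDr !scalerA.
by rewrite mulrC.
Qed.
HB.instance Definition _ a w X :=
  GRing.isLinear.Build K _ _ _ (@tensor a w X) (@tensor_linear a w X).

Definition single a (i : 'I_a) X (x : X) : {ffun 'I_a -> X} :=
  [ffun i' => if i' == i then x else 0].

Fact single_linear a (i : 'I_a) X : linear (@single a i X).
Proof.
move=> c x y; apply/ffunP => j; rewrite !ffunE; case: eqP => // _.
by rewrite scaler0 addr0.
Qed.
HB.instance Definition _ a i X :=
  GRing.isLinear.Build K _ _ _ (@single a i X) (@single_linear a i X).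

Lemma single_sum a X (y : {ffun 'I_a -> X}) : \sum_i single i (y i) = y.
Proof.
apply/ffunP => j; rewrite sum_ffunE (bigD1 j) //= ffunE eqxx big1 ?addr0 // => i ij.
by rewrite ffunE eq_sym (negbTE ij).
Qed.

Lemma tensor_sum a b (w : 'rV[K]_a) (B : 'M[K]_(a, b)) X (y : X) :
  \sum_j w 0 j *: tensor (row j B) y = tensor (w *m B) y.
Proof.
apply/ffunP => t; rewrite sum_ffunE ffunE mxE scaler_suml.
by apply: eq_bigr => j _; rewrite !ffunE mxE scalerA.
Qed.

Lemma single_sumE a (w : 'rV[K]_a) X (x : X) : \sum_j w 0 j *: single j x = tensor w x.
Proof.
rewrite -[RHS]single_sum; apply: eq_bigr => j _.
by rewrite ffunE linearZ.
Qed.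

Lemma mxact_tensor a b (w : 'rV[K]_a) (B : 'M[K]_(a, b)) X (y : X) :
  mxact B (tensor w y) = tensor (w *m B) y.
Proof.
rewrite -tensor_sum; apply/ffunP => t; rewrite sum_ffunE ffunE.
by apply: eq_bigr => j _; rewrite !ffunE !mxE !scalerA mulrC.
Qed.

Lemma mxact_single a b (j : 'I_a) (B : 'M[K]_(a, b)) X (x : X) :
  mxact B (single j x) = tensor (row j B) x.
Proof.
apply/ffunP => t; rewrite !ffunE (bigD1 j) //= ffunE eqxx mxE big1 ?addr0 // => i ij.
by rewrite ffunE (negbTE ij) scaler0.
Qed.

Lemma tensor0 a X (y : X) : tensor (0 : 'rV[K]_a) y = 0.
Proof. by apply/ffunP => t; rewrite !ffunE mxE scale0r. Qed.

Definition fmap a X Y (f : X -> Y) (y : {ffun 'I_a -> X}) : {ffun 'I_a -> Y} :=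
  [ffun t => f (y t)].

Fact fmap_linear a X Y (f : {linear X -> Y}) : linear (@fmap a X Y f).
Proof. by move=> c y y'; apply/ffunP => t; rewrite !ffunE linearP. Qed.
HB.instance Definition _ a X Y (f : {linear X -> Y}) :=
  GRing.isLinear.Build K _ _ _ (@fmap a X Y f) (@fmap_linear a X Y f).

Lemma fmap_tensor a (w : 'rV[K]_a) X Y (f : {linear X -> Y}) x :
  fmap f (tensor w x) = tensor w (f x).
Proof. by apply/ffunP => t; rewrite !ffunE linearZ. Qed.

End MatrixAction.

(** * The projective modules *)

Section RestrictScalars.
Variables (K : fieldType) (n m : nat) (V W : 'I_m -> {vspace 'rV[K]_n}).
Local Notation R := (algR V W).
Local Notation kk := (kk V W).
Local Notation ee := (ee V W).
Local Notation cc := (cc V W).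
Local Notation bb := (bb V W).

(** An alias, so that the same group can carry its [R]-action and the [K]-action through [kk]. *)
Definition resK (N : lmodType R) : Type := N.

Section Instances.
Variable N : lmodType R.
HB.instance Definition _ := GRing.Zmodule.on (resK N).
Definition resK_scale (c : K) (x : resK N) : resK N := kk c *: (x : N).
Fact resK_scaleA c d x : resK_scale c (resK_scale d x) = resK_scale (c * d) x.
Proof. by rewrite /resK_scale scalerA kkM. Qed.
Fact resK_scale1 : left_id 1 resK_scale.
Proof. by move=> x; rewrite /resK_scale kk1 scale1r. Qed.
Fact resK_scaleDr : right_distributive resK_scale +%R.
Proof. by move=> c x y; apply: (@scalerDr R N). Qed.
Fact resK_scaleDl x : {morph resK_scale^~ x : c d / c + d}.
Proof. by move=> c d; rewrite /resK_scale kkD scalerDl. Qed.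
HB.instance Definition _ := GRing.Zmodule_isLmodule.Build K (resK N)
  resK_scaleA resK_scale1 resK_scaleDr resK_scaleDl.
End Instances.

Lemma resK_scaleE (N : lmodType R) c (x : resK N) : c *: x = kk c *: (x : N) :> N.
Proof. by []. Qed.

Lemma resK_linear (M N : lmodType R) (f : {linear M -> N}) :
  linear (f : resK M -> resK N).
Proof. by move=> c x y; rewrite resK_scaleE linearP. Qed.

Lemma kk_sum I (s : seq I) (F : I -> K) :
  kk (\sum_(i <- s) F i) = \sum_(i <- s) kk (F i).
Proof. exact: (big_morph kk (@kkD _ _ _ _ _) (@kk0 _ _ _ _ _)). Qed.

Definition clin (w : 'rV[K]_n) : R := \sum_j kk (w 0 j) * cc j.

Lemma clin_delta j : clin (delta_mx 0 j) = cc j.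
Proof.
rewrite /clin (bigD1 j) //= big1 ?addr0 => [|i ij].
  by rewrite mxE !eqxx kk1 mul1r.
by rewrite mxE (negbTE ij) andbF kk0 mul0r.
Qed.

Lemma clinD w w' : clin (w + w') = clin w + clin w'.
Proof.
by rewrite /clin -big_split; apply: eq_bigr => j _; rewrite mxE kkD mulrDl.
Qed.

Lemma clin_mul a (w : 'rV[K]_a) (B : 'M[K]_(a, n)) :
  clin (w *m B) = \sum_t kk (w 0 t) * clin (row t B).
Proof.
rewrite /clin; under eq_bigr do rewrite mxE kk_sum mulr_suml.
rewrite exchange_big; apply: eq_bigr => t _; rewrite mulr_sumr.
by apply: eq_bigr => j _; rewrite kkM mulrA mxE.
Qed.

Lemma ee_clin v w : ee v * clin w = if v then clin w else 0.
Proof.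
rewrite /clin mulr_sumr; case: v.
  by apply: eq_bigr => j _; rewrite mulrA -kkC -mulrA ee_cc.
by rewrite big1 // => j _; rewrite mulrA -kkC -mulrA ee_cc mulr0.
Qed.

Lemma cc_clin j w : cc j * clin w = 0.
Proof.
rewrite /clin mulr_sumr big1 // => i _.
by rewrite mulrA -kkC -mulrA cc_cc mulr0.
Qed.

Lemma bb_clin_bb i w i' : bb i * (clin w * bb i') = 0.
Proof.
rewrite /clin mulr_suml mulr_sumr big1 // => j _.
by rewrite mulrA (mulrA (bb i)) -kkC -!mulrA [bb i * _]mulrA bb_cc_bb mulr0.
Qed.

End RestrictScalars.

Section Modules.
Variables (K : fieldType) (n m k h : nat) (V W : 'I_m -> {vspace 'rV[K]_n}).
Variables (fV : forall i, frame (V i) k h) (fW : forall i, frame (W i) h k).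
Local Notation R := (algR V W).
Local Notation kk := (kk V W).
Local Notation ee := (ee V W).
Local Notation cc := (cc V W).
Local Notation bb := (bb V W).
Local Notation clin := (@clin K n m V W).
Local Notation A i := (fr_out (fW i)).
Local Notation D i := (fr_out (fV i)).
Implicit Types X Y : lmodType K.

Lemma inW_mul0 i (w : 'rV[K]_n) : w *m A i = 0 -> clin w * bb i = 0.
Proof. by move=> w0; apply: cc_bb_rel; rewrite (fr_mem (fW i)) w0. Qed.

Lemma inV_mul0 i (v : 'rV[K]_n) : v *m D i = 0 -> bb i * clin v = 0.
Proof. by move=> v0; apply: bb_cc_rel; rewrite (fr_mem (fV i)) v0. Qed.

(* Lifts to [C] of the basis of [C / W_i] (resp. [C / V_i]) chosen by the frame. *)
Definition lift_W i t : R := clin (row t (fr_sec (fW i))).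
Definition lift_V i r : R := clin (row r (fr_sec (fV i))).

Lemma cc_bbE j i : cc j * bb i = \sum_t kk (A i j t) * (lift_W i t * bb i).
Proof.
(* The vector [c_j] minus the chosen lift of its class modulo [W i] lies in [W i], hence is killed
   by right multiplication by [b_i]. *)
have /inW_mul0 : (delta_mx 0 j - row j (A i) *m fr_sec (fW i)) *m A i = 0.
  by rewrite mulmxBl -mulmxA fr_secK mulmx1 rowE subrr.
rewrite clinD clin_delta mulrDl -mulNmx clin_mul => /eqP; rewrite addr_eq0 => /eqP ->.
rewrite mulr_suml -sumrN; apply: eq_bigr => t _.
rewrite !mxE mulrA -mulNr -mulNr; congr (_ * _ * _).
by apply/eqP; rewrite eq_sym -subr_eq0 opprK -kkD subrr kk0.
Qed.

Lemma bb_ccE j i : bb i * cc j = \sum_r kk (D i j r) * (bb i * lift_V i r).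
Proof.
have /inV_mul0 : (delta_mx 0 j - row j (D i) *m fr_sec (fV i)) *m D i = 0.
  by rewrite mulmxBl -mulmxA fr_secK mulmx1 rowE subrr.
rewrite clinD clin_delta mulrDr -mulNmx clin_mul => /eqP; rewrite addr_eq0 => /eqP ->.
rewrite mulr_sumr -sumrN; apply: eq_bigr => t _.
rewrite !mxE mulrA -kkC -mulrA -mulNr; congr (_ * _).
by apply/eqP; rewrite eq_sym -subr_eq0 opprK -kkD subrr kk0.
Qed.

(* [S_1 (x) X1 + S_2 (x) X2], with [S_1], [S_2] the simple modules. *)
Definition rS X1 X2 : rep V W.
Proof.
apply: (@Rep K n m V W X1 X2 
  (fun=> (\0 : {linear X1 -> X2})) (fun=> (\0 : {linear X2 -> X1}))) => //.
by move=> i w u _; rewrite big1 // => j _; exact: scaler0.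
Defined.

(* [R b_i (x) Y]: a copy of [b_i (x) Y] and one of [(C / W_i) b_i (x) Y]. *)
Definition rM (i : 'I_m) Y : rep V W.
Proof.
apply: (@Rep K n m V W Y {ffun 'I_k -> Y} 
  (fun j => (@tensor K k (row j (A i)) Y : {linear Y -> {ffun 'I_k -> Y}}))
  (fun=> (\0 : {linear {ffun 'I_k -> Y} -> Y}))) => //.
move=> i' w u _; rewrite big1 // => j _; rewrite linear0; exact: scaler0.
Defined.

Section Tail.
Variable Y : lmodType K.

(** [R e_1], [R e_2] and the syzygies below all contain a sum of modules [R b_i (x) Y]; this is the
    common action of [c_j] on that part. *)
Definition tail_c j (y : {ffun 'I_m -> Y}) : {ffun 'I_m -> {ffun 'I_k -> Y}} :=
  [ffun i => tensor (row j (A i)) (y i)].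

Fact tc_linear j : linear (tail_c j).
Proof. by move=> c y y'; apply/ffunP => i; rewrite !ffunE linearP. Qed.

Lemma tc_rel (w : 'rV[K]_n) (y : {ffun 'I_m -> Y}) :
  \sum_j w 0 j *: tail_c j y = [ffun i => tensor (w *m A i) (y i)].
Proof.
apply/ffunP => i; rewrite sum_ffunE ffunE -tensor_sum; apply: eq_bigr => j _.
by rewrite !ffunE.
Qed.

Lemma tail_c_single (w : 'rV[K]_n) i (y : Y) : w \in W i -> \sum_j w 0 j *: tail_c j (single i y) = 0.
Proof.
rewrite (fr_mem (fW i)) tc_rel => /eqP w0; apply/ffunP => i'; rewrite !ffunE.
by case: eqP => [->|_]; rewrite ?linear0 // w0 tensor0.
Qed.

Variable N : lmodType R.

(* The map from [+_i R b_i (x) Y] sending [b_i (x) y] to [b_i phi_i(y)]. *)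
Definition tail_map (phi : 'I_m -> Y -> N) (y : {ffun 'I_m -> Y})
    (q : {ffun 'I_m -> {ffun 'I_k -> Y}}) : N :=
  \sum_i (bb i *: phi i (y i) + \sum_t (lift_W i t * bb i) *: phi i (q i t)).

Variable phi : 'I_m -> {linear Y -> resK N}.

Let phiZ i c y : (phi i (c *: y) : N) = kk c *: (phi i y : N).
Proof. exact: (linearZZ (phi i)). Qed.
Let phiD i y y' : (phi i (y + y') : N) = (phi i y : N) + (phi i y' : N).
Proof. exact: (linearD (phi i)). Qed.
Let phi0 i : (phi i 0 : N) = 0.
Proof. exact: (linear0 (phi i)). Qed.

Lemma tlD y q y' q' : tail_map phi (y + y') (q + q') = tail_map phi y q + tail_map phi y' q'.
Proof.
rewrite /tail_map -big_split; apply: eq_bigr => i _ /=.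
rewrite addrACA ffunE phiD scalerDr; congr (_ + _).
by rewrite -big_split; apply: eq_bigr => t _; rewrite !ffunE phiD scalerDr.
Qed.

Lemma tlZ c y q : tail_map phi (c *: y) (c *: q) = kk c *: tail_map phi y q.
Proof.
rewrite /tail_map scaler_sumr; apply: eq_bigr => i _.
rewrite scalerDr ffunE phiZ !scalerA kkC; congr (_ + _).
rewrite scaler_sumr; apply: eq_bigr => t _.
by rewrite !ffunE phiZ !scalerA kkC.
Qed.

Lemma tl_ee v y q :
  ee v *: tail_map phi y q = if v then tail_map phi 0 q else tail_map phi y 0.
Proof.
rewrite /tail_map scaler_sumr; case: v; apply: eq_bigr => i _;
  rewrite scalerDr scalerA ee_bb scaler_sumr; congr (_ + _).
- by rewrite scale0r ffunE phi0 scaler0.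
- by apply: eq_bigr => t _; rewrite scalerA mulrA ee_clin.
- rewrite !big1 // => t _; first by rewrite !ffunE phi0 scaler0.
  by rewrite scalerA mulrA ee_clin mul0r scale0r.
Qed.

Lemma tl_cc j y q : cc j *: tail_map phi y q = tail_map phi 0 (tail_c j y).
Proof.
rewrite /tail_map scaler_sumr; apply: eq_bigr => i _.
rewrite scalerDr ffunE phi0 scaler0 add0r [X in _ + X](_ : _ = 0) ?addr0; last first.
  by rewrite scaler_sumr big1 // => t _; rewrite scalerA mulrA cc_clin mul0r scale0r.
rewrite scalerA cc_bbE scaler_suml; apply: eq_bigr => t _.
by rewrite !ffunE phiZ scalerA mxE kkC.
Qed.

Lemma tl_bb i y q : bb i *: tail_map phi y q = 0.
Proof.
rewrite /tail_map scaler_sumr big1 // => i' _.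
rewrite scalerDr scalerA bb_bb scale0r add0r scaler_sumr big1 // => t _.
by rewrite scalerA bb_clin_bb scale0r.
Qed.

Lemma tail_map_single i y : tail_map phi (single i y) 0 = bb i *: phi i y.
Proof.
rewrite /tail_map (bigD1 i) //= !ffunE eqxx !big1 ?addr0 // => [i' ii'|t _].
  rewrite !ffunE (negbTE ii') phi0 scaler0 add0r big1 // => t _.
  by rewrite !ffunE phi0 scaler0.
by rewrite !ffunE phi0 scaler0.
Qed.

End Tail.

End Modules.

Lemma rep_hom (K : fieldType) n m (V W : 'I_m -> {vspace 'rV[K]_n}) (rho : rep V W)
    (N : lmodType (algR V W)) (f : rep1 rho * rep2 rho -> N) :
  {morph f : u u' / u + u'} ->
  (forall c u, f (c *: u) = kk V W c *: f u) ->
  (forall v u, ee V W v *: f u = f (if v then (0, u.2) else (u.1, 0))) ->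
  (forall j u, cc V W j *: f u = f (0, rep_c rho j u.1)) ->
  (forall i u, bb V W i *: f u = f (rep_b rho i u.2, 0)) ->
  linear (f : rep_mod rho -> N).
Proof.
move=> fD fk fe fc fb; apply: linear_on_generators => //.
- by move=> c -[u1 u2]; have := rep_kk c u1 u2; rewrite /rep_in => ->; exact: (fk c (u1, u2)).
- by move=> v -[u1 u2]; have := rep_ee v u1 u2; rewrite /rep_in => ->; rewrite fe.
- by move=> j -[u1 u2]; have := rep_cc j u1 u2; rewrite /rep_in => ->; rewrite fc.
- by move=> i -[u1 u2]; have := rep_bb i u1 u2; rewrite /rep_in => ->; rewrite fb.
Qed.

(** * Projectivity of the modules [R e_1 (x) X] and [R e_2 (x) X] *)

Section Projectives.
Variables (K : fieldType) (n m k h : nat) (V W : 'I_m -> {vspace 'rV[K]_n}).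
Variables (fV : forall i, frame (V i) k h) (fW : forall i, frame (W i) h k).
Local Notation R := (algR V W).
Local Notation kk := (kk V W).
Local Notation ee := (ee V W).
Local Notation cc := (cc V W).
Local Notation bb := (bb V W).
Local Notation D i := (fr_out (fV i)).
Local Notation tail_c := (tail_c fW).
Local Notation tail_map := (tail_map fW).
Local Notation lift_V := (@lift_V K n m k h V W fV).
Variable X : lmodType K.
Local Notation Y := {ffun 'I_h -> X}.

Fact p2c_linear j :
  linear (fun y : {ffun 'I_m -> X} => (0 : X, tail_c j y) : (X * {ffun 'I_m -> {ffun 'I_k -> X}})%type).
Proof.
move=> c y y'; rewrite tc_linear [RHS](_ : _ = (c *: 0 + 0, c *: tail_c j y + tail_c j y')) //.
by rewrite scaler0 addr0.
Qed.

Fact p2b_linear (i : 'I_m) :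
  linear (fun z : (X * {ffun 'I_m -> {ffun 'I_k -> X}})%type => single i z.1).
Proof. by move=> c z z'; rewrite -linearP. Qed.

(* [R e_2 (x) X], whose elements [(y, (x, q))] stand for
   [e_2 (x) x + sum_i b_i (x) y_i + sum_(i, t) a_it b_i (x) q_it]. *)
Definition rP2 : rep V W.
Proof.
apply: (@Rep K n m V W {ffun 'I_m -> X} (X * {ffun 'I_m -> {ffun 'I_k -> X}})%type
  (fun j => linof (p2c_linear j)) (fun i => linof (p2b_linear i))).
- by move=> i j i' u; rewrite /= linear0.
- move=> i w u wW; rewrite pair_sum; congr pair; last exact: tail_c_single.
  by rewrite big1 // => j _; exact: scaler0.
- move=> i v u vV; rewrite pair_sum /= big1 ?linear0 // => j _.
  exact: scaler0.
Defined.

Fact p1c_linear j :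
  linear (fun u : (X * {ffun 'I_m -> Y})%type =>
    (single j u.1, tail_c j u.2) : ({ffun 'I_n -> X} * {ffun 'I_m -> {ffun 'I_k -> Y}})%type).
Proof.
move=> c y y'; rewrite [X in X = _](_ : _ = (single j (c *: y.1 + y'.1), tail_c j (c *: y.2 + y'.2))) //.
by rewrite linearP tc_linear.
Qed.

Fact p1b_linear i :
  linear (fun z : ({ffun 'I_n -> X} * {ffun 'I_m -> {ffun 'I_k -> Y}})%type =>
    (0 : X, single i (mxact (D i) z.1)) : (X * {ffun 'I_m -> Y})%type).
Proof.
move=> c z z'; rewrite [X in X = _](_ : _ = (0, single i (mxact (D i) (c *: z.1 + z'.1)))) //.
rewrite !linearP; congr pair.
by rewrite /= scaler0 addr0.
Qed.

(* [R e_1 (x) X], whose elements [((x, y), (z, q))] stand for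
   [e_1 (x) x + sum b_i u_ir (x) y_ir + sum c_j (x) z_j
    + sum a_it b_i u_ir (x) q_itr]. *)
Definition rP1 : rep V W.
Proof.
apply: (@Rep K n m V W (X * {ffun 'I_m -> Y})%type
  ({ffun 'I_n -> X} * {ffun 'I_m -> {ffun 'I_k -> Y}})%type
  (fun j => linof (p1c_linear j)) (fun i => linof (p1b_linear i))).
- by move=> i j i' u; rewrite /= !linear0.
- move=> i w u wW; rewrite pair_sum; congr pair; last exact: tail_c_single.
  by rewrite big1 // => j _; rewrite /= linear0; exact: scaler0.
- move=> i v u; rewrite (fr_mem (fV i)) => /eqP v0.
  rewrite pair_sum /= -[X in mxact _ X]/(\sum_j v 0 j *: single j u.1) single_sumE.
  by rewrite mxact_tensor v0 tensor0 linear0.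
Defined.

Section Maps.
Variable N : lmodType R.

(* The maps [R e_2 (x) X -> N] and [R e_1 (x) X -> N] extending [s]. *)
Definition hP2 (s : X -> N) (u : rep_mod rP2) : N :=
  ee true *: s u.2.1 + tail_map (fun=> s) u.1 u.2.2.

(** Evaluates an element of [(C / V_i) (x) X] through lifts to [C]. The value depends on the frame,
    but its product with [b_i] does not, because [b_i V_i = 0]. *)
Definition psi (s : X -> N) (i : 'I_m) (y : Y) : N := \sum_r lift_V i r *: s (y r).

Definition hP1 (s : X -> N) (u : rep_mod rP1) : N :=
  ee false *: s u.1.1 + \sum_j cc j *: s (u.2.1 j) + tail_map (psi s) u.1.2 u.2.2.

Variable s : {linear X -> resK N}.

Let sZ c x : (s (c *: x) : N) = kk c *: (s x : N).
Proof. exact: (linearZZ s). Qed.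
Let sD x x' : (s (x + x') : N) = (s x : N) + (s x' : N).
Proof. exact: (linearD s). Qed.
Let s0 : (s 0 : N) = 0.
Proof. exact: (linear0 s). Qed.

Fact psi_linear i : linear (psi s i : Y -> resK N).
Proof.
move=> c y y'; rewrite /psi resK_scaleE scaler_sumr -big_split; apply: eq_bigr => r _ /=.
by rewrite !ffunE sD sZ scalerDr !scalerA kkC.
Qed.

Lemma hP2_linear : linear (hP2 s).
Proof.
apply: rep_hom.
- move=> u u'; rewrite /hP2 addrACA -scalerDr -sD; congr (_ + _).
  exact: (tlD fW (fun=> s)).
- move=> c u; rewrite /hP2 scalerDr -(tlZ fW (fun=> s)) scalerA kkC -scalerA -sZ.
  by [].
- move=> v u; rewrite /hP2 scalerDr (tl_ee fW (fun=> s)) scalerA ee_ee.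
  by case: v => /=; rewrite ?s0 ?scaler0 ?scale0r.
- move=> j u; rewrite /hP2 scalerDr (tl_cc fW (fun=> s)) scalerA cc_ee.
  by rewrite /= s0 scaler0 scale0r.
- move=> i u; rewrite /hP2 scalerDr (tl_bb fW (fun=> s)) scalerA bb_ee.
  by rewrite /= s0 scaler0 add0r (tail_map_single fW (fun=> s)) addr0.
Qed.

Lemma hP1_linear : linear (hP1 s).
Proof.
pose phi i := linof (psi_linear i).
(* After [b_i], a vector of [C] and the lift of its class modulo [V i] agree. This is what makes
   [hP1] commute with [b_i]. *)
have bphi i w : bb i *: phi i (mxact (D i) w) = bb i *: (\sum_j cc j *: s (w j)) :> N.
  rewrite /phi /= /psi !scaler_sumr.
  under eq_bigr => r _.
    rewrite ffunE (linear_sum s) scalerA scaler_sumr.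
    under eq_bigr => j _ do rewrite [s _]sZ scalerA -kkC.
    over.
  rewrite exchange_big; apply: eq_bigr => j _ /=.
  by rewrite [RHS]scalerA (bb_ccE W fV) scaler_suml.
apply: rep_hom.
- move=> u u'; rewrite /hP1 [RHS]addrACA [X in _ = X + _]addrACA -scalerDr -sD.
  rewrite -big_split /=; congr (_ + _ + _); last exact: (tlD fW phi).
  by apply: eq_bigr => j _; rewrite ffunE sD scalerDr.
- move=> c u; rewrite /hP1 !scalerDr -(tlZ fW phi) scalerA kkC -scalerA -sZ.
  congr (_ + _ + _); rewrite scaler_sumr; apply: eq_bigr => j _.
  by rewrite ffunE sZ !scalerA kkC.
- move=> v u; rewrite /hP1 !scalerDr (tl_ee fW phi) scalerA ee_ee scaler_sumr.
  case: v => /=.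
    rewrite s0 scaler0 scale0r !add0r; congr (_ + _).
    by apply: eq_bigr => j _; rewrite scalerA ee_cc.
  congr (_ + _ + _); rewrite !big1 // => j _; first by rewrite ffunE s0 scaler0.
  by rewrite scalerA ee_cc scale0r.
- move=> j u; rewrite /hP1 !scalerDr (tl_cc fW phi) scalerA cc_ee scaler_sumr.
  rewrite /= s0 scaler0 add0r; congr (_ + _).
  rewrite [X in _ + X]big1 ?addr0 => [|i _]; last by rewrite scalerA cc_cc scale0r.
  rewrite (bigD1 j) //= ffunE eqxx big1 ?addr0 // => i ij.
  by rewrite ffunE (negbTE ij) s0 scaler0.
- move=> i u; rewrite /hP1 !scalerDr (tl_bb fW phi) scalerA bb_ee.
  rewrite /= s0 scaler0 scale0r !add0r addr0 (tail_map_single fW phi) bphi.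
  rewrite [X in X + _]big1 ?add0r // => j _; by rewrite ffunE s0 scaler0.
Qed.

End Maps.

Lemma tl_nat (Y' : lmodType K) (M N : lmodType R) (f : {linear M -> N})
    (phi : 'I_m -> Y' -> M) (phi' : 'I_m -> Y' -> N) y q :
  (forall i x, phi' i x = f (phi i x)) -> f (tail_map phi y q) = tail_map phi' y q.
Proof.
move=> E; rewrite /tail_map linear_sum; apply: eq_bigr => i _.
rewrite linearD linearZ linear_sum -E; congr (_ + _).
by apply: eq_bigr => t _; rewrite linearZ -E.
Qed.

Lemma hP2_nat (M N : lmodType R) (f : {linear M -> N}) s u :
  f (hP2 s u) = hP2 (f \o s) u.
Proof. by rewrite /hP2 linearD linearZ (tl_nat (phi' := fun=> f \o s)). Qed.

Lemma hP1_nat (M N : lmodType R) (f : {linear M -> N}) s u :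
  f (hP1 s u) = hP1 (f \o s) u.
Proof.
rewrite /hP1 !linearD linearZ linear_sum (tl_nat (phi' := psi (f \o s))).
  by congr (_ + _ + _); apply: eq_bigr => j _; rewrite linearZ.
by move=> i y; rewrite /psi linear_sum; apply: eq_bigr => r _; rewrite linearZ.
Qed.

Definition iP2 (x : X) : rep_mod rP2 := rep_in (rho := rP2) (0, (x, 0)).
Definition iP1 (x : X) : rep_mod rP1 := rep_in (rho := rP1) ((x, 0), (0, 0)).

End Projectives.

Lemma rep_clin (K : fieldType) n m (V W : 'I_m -> {vspace 'rV[K]_n}) (rho : rep V W)
    w (u1 : rep1 rho) (u2 : rep2 rho) :
  clin V W w *: rep_in (u1, u2) = rep_in (0, \sum_j w 0 j *: rep_c rho j u1).
Proof.
rewrite /clin scaler_suml.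
under eq_bigr do rewrite -scalerA rep_cc rep_kk scaler0.
by rewrite [LHS]pair_sum big1.
Qed.

Lemma rep_in_sum (K : fieldType) n m (V W : 'I_m -> {vspace 'rV[K]_n}) (rho : rep V W)
    I (s : seq I) (F : I -> rep1 rho) (G : I -> rep2 rho) :
  \sum_(i <- s) rep_in (F i, G i) = rep_in (\sum_(i <- s) F i, \sum_(i <- s) G i).
Proof. exact: pair_sum. Qed.

Lemma rep_inD (K : fieldType) n m (V W : 'I_m -> {vspace 'rV[K]_n}) (rho : rep V W)
    (u1 v1 : rep1 rho) (u2 v2 : rep2 rho) :
  rep_in (u1, u2) + rep_in (v1, v2) = rep_in (u1 + v1, u2 + v2).
Proof. by []. Qed.

Lemma pair0_sum (U1 U2 : nmodType) I (s : seq I) (G : I -> U2) :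
  \sum_(i <- s) ((0, G i) : (U1 * U2)%type) = (0, \sum_(i <- s) G i).
Proof. by rewrite pair_sum /= big1. Qed.

Section ProjectivesTheory.
Variables (K : fieldType) (n m k h : nat) (V W : 'I_m -> {vspace 'rV[K]_n}).
Variables (fV : forall i, frame (V i) k h) (fW : forall i, frame (W i) h k).
Local Notation R := (algR V W).
Local Notation bb := (bb V W).
Local Notation tail_c := (tail_c fW).
Local Notation lift_W := (@lift_W K n m k h V W fW).
Local Notation lift_V := (@lift_V K n m k h V W fV).
Variable X : lmodType K.

Lemma tensor_row_secK b (i : 'I_m) (t : 'I_k) (Y : lmodType K) (y : Y) :
  tensor (row t (fr_sec (fW b)) *m fr_out (fW b)) y = single t y.
Proof.
rewrite -row_mul fr_secK; apply/ffunP => s; rewrite !ffunE !mxE eq_sym.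
by case: eqP => _; rewrite ?scale1r ?scale0r.
Qed.

Lemma tc_row_sec i t (Y : lmodType K) (y : Y) :
  \sum_j row t (fr_sec (fW i)) 0 j *: tail_c j (single i y) = single i (single t y).
Proof.
rewrite tc_rel; apply/ffunP => i'; rewrite !ffunE; case: eqP => [->|_].
  exact: tensor_row_secK.
exact: linear0.
Qed.

Lemma sum_single2 (Y : lmodType K) (q : {ffun 'I_m -> {ffun 'I_k -> Y}}) :
  \sum_i \sum_t single i (single t (q i t)) = q.
Proof.
rewrite -[RHS]single_sum; apply: eq_bigr => i _.
by rewrite -linear_sum single_sum.
Qed.

Lemma bb_iP2 i (x : X) : bb i *: iP2 V fW x = rep_in (rho := rP2 V fW X) (single i x, 0).
Proof. exact: rep_bb. Qed.

Lemma aabb_iP2 i t (x : X) :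
  (lift_W i t * bb i) *: iP2 V fW x = rep_in (rho := rP2 V fW X) (0, (0, single i (single t x))).
Proof.
rewrite -scalerA bb_iP2 rep_clin; congr (rep_in (_, _)).
rewrite /= pair_sum; congr pair; last exact: tc_row_sec.
by rewrite big1 // => j _; exact: scaler0.
Qed.

Lemma tl_iP2 y q : tail_map fW (fun=> iP2 V fW (X := X)) y q =
  rep_in (rho := rP2 V fW X) (y, (0, q)).
Proof.
rewrite /tail_map; transitivity (\sum_i rep_in (rho := rP2 V fW X)
    (single i (y i), (0, \sum_t single i (single t (q i t))))).
  apply: eq_bigr => i _; rewrite bb_iP2.
  under eq_bigr do rewrite aabb_iP2.
  rewrite rep_in_sum [X in _ + rep_in (X, _)]big1 // [X in rep_in (0, X)]pair0_sum.
  by rewrite rep_inD addr0 add0r.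
rewrite rep_in_sum; congr (rep_in (_, _)); first exact: single_sum.
by rewrite [LHS]pair0_sum sum_single2.
Qed.

Lemma hP2_id u : hP2 (fW := fW) (iP2 V fW (X := X)) u = u.
Proof.
case: u => y [x q]; rewrite /hP2 tl_iP2 rep_ee rep_inD.
by congr (_, (_, _)); [exact: add0r|exact: addr0|exact: add0r].
Qed.

(** By [hP2_nat] and [hP2_id], a map out of [R e_2 (x) X] is the extension of its restriction to
    [X], so lifting it reduces to lifting a map of vector spaces. That lift need not take values in
    [e_2 M], since [hP2] multiplies by the idempotent. *)
Lemma rP2_projective : projective (rep_mod (rP2 V fW X) : lmodType R).
Proof.
move=> M N f g fs.
have gl : linear (g \o iP2 V fW (X := X) : X -> resK N).
  move=> c x y; rewrite resK_scaleE /= -linearZ -linearD; congr (g _).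
  rewrite rep_kk rep_inD; congr (_, _).
    by rewrite scaler0 addr0.
  by rewrite -(linearP (pairl X {ffun 'I_m -> {ffun 'I_k -> X}})).
have [s sE] := @vector_space_projective K X _ _ (linof (resK_linear f)) (linof gl) fs.
exists (linof (hP2_linear (fW := fW) s)) => u /=.
by rewrite hP2_nat -[in RHS](hP2_id u) hP2_nat; congr (hP2 _ u); apply/funext => x; exact: sE.
Qed.

Lemma clin_iP1 w (x : X) :
  clin V W w *: iP1 fV fW x = rep_in (rho := rP1 fV fW X) (0, (tensor w x, 0)).
Proof.
rewrite rep_clin; congr (rep_in (_, _)); rewrite pair_sum; congr pair.
  exact: single_sumE.
rewrite big1 // => j _ /=; rewrite [tail_c j 0](linear0 (linof (tc_linear fW j))).
exact: scaler0.
Qed.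

Lemma bb_psi_iP1 i y : bb i *: psi fV (iP1 fV fW (X := X)) i y =
  rep_in (rho := rP1 fV fW X) ((0, single i y), 0).
Proof.
rewrite /psi; under eq_bigr do rewrite clin_iP1.
rewrite [X in _ *: X]pair_sum big1 // pair_sum /= rep_bb; congr (rep_in (_, _)).
congr (_, single i _) => /=; rewrite linear_sum -[RHS]single_sum; apply: eq_bigr => r _ /=.
rewrite mxact_tensor -row_mul fr_secK; apply/ffunP => s; rewrite !ffunE !mxE eq_sym.
by case: eqP => _; rewrite ?scale1r ?scale0r.
Qed.

Lemma aabb_psi_iP1 i t y : (lift_W i t * bb i) *: psi fV (iP1 fV fW (X := X)) i y =
  rep_in (rho := rP1 fV fW X) (0, (0, single i (single t y))).
Proof.
rewrite -scalerA bb_psi_iP1 rep_clin; congr (rep_in (_, _)).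
rewrite /= pair_sum; congr pair; last exact: tc_row_sec.
by rewrite big1 // => j _; rewrite /= linear0; exact: scaler0.
Qed.

Lemma tl_iP1 y q : tail_map fW (psi fV (iP1 fV fW (X := X))) y q =
  rep_in (rho := rP1 fV fW X) ((0, y), (0, q)).
Proof.
rewrite /tail_map; transitivity (\sum_i rep_in (rho := rP1 fV fW X)
    ((0, single i (y i)), (0, \sum_t single i (single t (q i t))))).
  apply: eq_bigr => i _; rewrite bb_psi_iP1.
  under eq_bigr do rewrite aabb_psi_iP1.
  rewrite rep_in_sum [X in _ + rep_in (X, _)]big1 // [X in rep_in (0, X)]pair0_sum.
  by rewrite rep_inD addr0 add0r.
rewrite rep_in_sum; congr (rep_in (_, _)); rewrite [LHS]pair0_sum.
  by rewrite single_sum.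
by rewrite sum_single2.
Qed.

Lemma sum_cc_iP1 (z : {ffun 'I_n -> X}) :
  \sum_j cc V W j *: iP1 fV fW (z j) = rep_in (rho := rP1 fV fW X) (0, (z, 0)).
Proof.
under eq_bigr do rewrite -clin_delta clin_iP1.
rewrite rep_in_sum big1 //; congr (rep_in (_, _)); rewrite [LHS]pair_sum /=.
congr (_, _); last by rewrite big1.
rewrite -[RHS]single_sum; apply: eq_bigr => j _; rewrite -single_sumE.
rewrite (bigD1 j) //= mxE !eqxx scale1r big1 ?addr0 // => i ij.
by rewrite mxE (negbTE ij) andbF scale0r.
Qed.

Lemma hP1_id u : hP1 (fW := fW) (iP1 fV fW (X := X)) u = u.
Proof.
case: u => [[x y] [z q]]; rewrite /hP1 tl_iP1 sum_cc_iP1 rep_ee !rep_inD.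
congr ((_, _), (_, _)).
- by rewrite /= !addr0.
- by rewrite /= !add0r.
- by rewrite /= addr0 add0r.
- by rewrite /= !add0r.
Qed.

Lemma rP1_projective : projective (rep_mod (rP1 fV fW X) : lmodType R).
Proof.
move=> M N f g fs.
have gl : linear (g \o iP1 fV fW (X := X) : X -> resK N).
  move=> c x y; rewrite resK_scaleE /= -linearZ -linearD; congr (g _).
  rewrite rep_kk rep_inD; congr (_, _).
    by rewrite -(linearP (pairl X {ffun 'I_m -> {ffun 'I_h -> X}})).
  by rewrite scaler0 addr0.
have [s sE] := @vector_space_projective K X _ _ (linof (resK_linear f)) (linof gl) fs.
exists (linof (hP1_linear (fV := fV) (fW := fW) s)) => u /=.
by rewrite hP1_nat -[in RHS](hP1_id u) hP1_nat; congr (hP1 _ u); apply/funext => x; exact: sE.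
Qed.

End ProjectivesTheory.

(** * Syzygies *)

Section KernelMatrices.
Variable K : fieldType.

Definition kmx a b (B : 'M[K]_(a, b)) : 'M[K]_(\rank (kermx B), a) := row_base (kermx B).
Definition kret a b (B : 'M[K]_(a, b)) := pinvmx (kmx B).

Lemma kmxK a b (B : 'M[K]_(a, b)) : kmx B *m kret B = 1%:M.
Proof. by apply: mulmxVp; exact: row_base_free. Qed.

Lemma kmx_mul a b (B : 'M[K]_(a, b)) : kmx B *m B = 0.
Proof. by apply/sub_kermxP; rewrite eq_row_base. Qed.

(** The row space splits into the left kernel of [B] and a complement, and [H] inverts [B] on that
    complement. *)
Lemma kmx_split a b (B : 'M[K]_(a, b)) : exists H, kret B *m kmx B + B *m H = 1%:M.
Proof.
(* With [pinvmx B] a generalised inverse, [G B = 0]; so the rows of [G] lie in the kernel and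
   [kret B *m kmx B] fixes them. *)
pose G := 1%:M - B *m pinvmx B.
have GB : G *m B = 0 by rewrite mulmxBl mul1mx mulmxKpV ?subrr.
have /submxP[C GC] : (G <= kmx B)%MS by rewrite eq_row_base; apply/sub_kermxP.
have GK : G *m kret B *m kmx B = G by rewrite GC -(mulmxA C) kmxK mulmx1.
exists (pinvmx B *m (1%:M - kret B *m kmx B)).
have -> : B *m (pinvmx B *m (1%:M - kret B *m kmx B)) = 1%:M - kret B *m kmx B.
  have BE : B *m pinvmx B = 1%:M - G by rewrite /G subKr.
  by rewrite mulmxA BE mulmxBl mul1mx mulmxBr mulmx1 (mulmxA G) GK subrr subr0.
by rewrite addrC subrK.
Qed.

(** Cokernel data by transposition: [cmx B] is the projection onto the cokernel of [B], and [csec B]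
    a section of it. *)
Definition cmx a b (B : 'M[K]_(a, b)) := (kmx B^T)^T.
Definition csec a b (B : 'M[K]_(a, b)) := (kret B^T)^T.

Lemma cmxK a b (B : 'M[K]_(a, b)) : csec B *m cmx B = 1%:M.
Proof. by rewrite -trmx_mul kmxK trmx1. Qed.

Lemma cmx_mul a b (B : 'M[K]_(a, b)) : B *m cmx B = 0.
Proof. by apply: trmx_inj; rewrite trmx_mul trmxK kmx_mul trmx0. Qed.

Lemma cmx_split a b (B : 'M[K]_(a, b)) : exists H, cmx B *m csec B + H *m B = 1%:M.
Proof.
have [H HE] := kmx_split B^T; exists H^T.
by apply: trmx_inj; rewrite linearD /= !trmx_mul !trmxK HE trmx1.
Qed.

End KernelMatrices.

(** * Explicit syzygies and the maps between them *)

Section RepMaps.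
Variables (K : fieldType) (n m : nat) (V W : 'I_m -> {vspace 'rV[K]_n}).
Local Notation R := (algR V W).

(** Compatibility with [rep_b] is required only on the image of [i]. This allows projections to a
    component that are linear on a submodule but not on the whole module. *)
Lemma rep_map_on (rho sigma : rep V W) (L : lmodType R) (i : {linear L -> rep_mod rho})
    (f1 : {linear rep1 rho -> rep1 sigma}) (f2 : {linear rep2 rho -> rep2 sigma}) :
  (forall j u, f2 (rep_c rho j u) = rep_c sigma j (f1 u)) ->
  (forall j x, f1 (rep_b rho j (i x).2) = rep_b sigma j (f2 (i x).2)) ->
  linear (fun x => rep_in (rho := sigma) (f1 (i x).1, f2 (i x).2)).
Proof.
move=> fc fb; apply: linear_on_generators.
- by move=> x y; rewrite linearD [LHS]/rep_in /= !linearD.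
- move=> c x; rewrite linearZ /=; case: (i x) => u1 u2.
  by have := rep_kk c u1 u2; rewrite {1 2}/rep_in => ->; rewrite rep_kk /= !linearZ.
- move=> v x; rewrite linearZ /=; case: (i x) => u1 u2.
  have := rep_ee v u1 u2; rewrite {1 2}/rep_in => ->; rewrite rep_ee.
  by case: v; rewrite /= linear0.
- move=> j x; rewrite linearZ /=; case: (i x) => u1 u2.
  have := rep_cc j u1 u2; rewrite {1 2}/rep_in => ->; rewrite rep_cc.
  by rewrite /= linear0 fc.
- move=> j x; rewrite linearZ /=; have := fb j x; case: (i x) => u1 u2 /= E.
  have := rep_bb j u1 u2; rewrite {1 2}/rep_in => ->; rewrite rep_bb.
  by rewrite /= linear0 E.
Qed.

Lemma rep_map (rho sigma : rep V W)
    (f1 : {linear rep1 rho -> rep1 sigma}) (f2 : {linear rep2 rho -> rep2 sigma}) :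
  (forall j u, f2 (rep_c rho j u) = rep_c sigma j (f1 u)) ->
  (forall j u, f1 (rep_b rho j u) = rep_b sigma j (f2 u)) ->
  linear (fun x : rep_mod rho => rep_in (rho := sigma) (f1 x.1, f2 x.2)).
Proof.
move=> fc fb; apply: (@rep_map_on _ _ _ (idfun : {linear rep_mod rho -> rep_mod rho}) f1 f2) => //.
Qed.

End RepMaps.

Section TailModules.
Variables (K : fieldType) (n m k h : nat) (V W : 'I_m -> {vspace 'rV[K]_n}).
Variables (fV : forall i, frame (V i) k h) (fW : forall i, frame (W i) h k).
Local Notation R := (algR V W).
Local Notation tail_c := (tail_c fW).
Implicit Types X Y : lmodType K.

Definition M_mod i Y : lmodType R := rep_mod (rM V fW i Y).
Definition P1_mod X : lmodType R := rep_mod (rP1 fV fW X).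
Definition P2_mod X : lmodType R := rep_mod (rP2 V fW X).
Definition S_mod X1 X2 : lmodType R := rep_mod (rS V W X1 X2).

Section FibreMaps.
Variables (a b : nat) (B : 'I_m -> 'M[K]_(a, b)) (X : lmodType K).

Definition fib (y : {ffun 'I_m -> {ffun 'I_a -> X}}) : {ffun 'I_m -> {ffun 'I_b -> X}} :=
  [ffun i => mxact (B i) (y i)].
Definition fibk (q : {ffun 'I_m -> {ffun 'I_k -> {ffun 'I_a -> X}}}) :
    {ffun 'I_m -> {ffun 'I_k -> {ffun 'I_b -> X}}} :=
  [ffun i => fmap (@mxact K a b (B i) X) (q i)].

Fact fib_linear : linear fib.
Proof. by move=> c y y'; apply/ffunP => i; rewrite !ffunE linearP. Qed.
Fact fibk_linear : linear fibk.
Proof. by move=> c y y'; apply/ffunP => i; rewrite !ffunE linearP. Qed.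
HB.instance Definition _ := GRing.isLinear.Build K _ _ _ fib fib_linear.
HB.instance Definition _ := GRing.isLinear.Build K _ _ _ fibk fibk_linear.

Lemma fibk_tc j y : fibk (tail_c j y) = tail_c j (fib y).
Proof. by apply/ffunP => i; rewrite !ffunE fmap_tensor. Qed.

Lemma fib_single i y : fib (single i y) = single i (mxact (B i) y).
Proof.
by apply/ffunP => i'; rewrite !ffunE; case: eqP => [->//|_]; rewrite linear0.
Qed.

End FibreMaps.

Section TailRep.
Variables (a b : nat) (B : 'I_m -> 'M[K]_(a, b)) (X : lmodType K).
Local Notation Z := {ffun 'I_m -> {ffun 'I_b -> X}}.
Local Notation Zk := {ffun 'I_m -> {ffun 'I_k -> {ffun 'I_b -> X}}}.

Fact gc_linear j : linear (fun y : Z => (0, tail_c j y) : ({ffun 'I_a -> X} * Zk)%type).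
Proof.
move=> c y y'; rewrite tc_linear.
exact: (linearP (pairr {ffun 'I_a -> X} Zk) c (tail_c j y) (tail_c j y')).
Qed.

Fact gb_linear i : linear (fun z : ({ffun 'I_a -> X} * Zk)%type => single i (mxact (B i) z.1)).
Proof. by move=> c z z'; rewrite -!linearP. Qed.

(* If [B i = T D_i] this is the submodule [z \in im T] of the radical of
   [R e_1 (x) X]: the syzygy of [S_1] for [T = 1], and the syzygy of [R b_i] for
   [T] a basis of [W_i]. *)
Definition rG : rep V W.
Proof.
apply: (@Rep K n m V W Z ({ffun 'I_a -> X} * Zk)%type
  (fun j => linof (gc_linear j)) (fun i => linof (gb_linear i))).
- by move=> i j i' u; rewrite /= !linear0.
- move=> i w u wW; rewrite pair_sum; congr pair; last exact: tail_c_single.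
  by rewrite big1 // => j _; exact: scaler0.
- move=> i v u vV; rewrite pair_sum /= big1 ?linear0 // => j _.
  exact: scaler0.
Defined.

Definition G_mod : lmodType R := rep_mod rG.

(** The map extending [e_2 (x) x |-> x]; its image is the submodule generated by [{ffun 'I_a -> X}],
    which is [N_i (x) X] when [B j = T D_j] with [T] a basis of [W_i]. *)
Fact phi_linear : linear (fun u : P2_mod {ffun 'I_a -> X} =>
  rep_in (rho := rG) (fib B u.1, (u.2.1, fibk B u.2.2))).
Proof.
pose f2 := pair_map (idfun : {linear {ffun 'I_a -> X} -> {ffun 'I_a -> X}})
  (linof (fibk_linear B (X := X))).
refine (@rep_map K n m V W (rP2 V fW {ffun 'I_a -> X}) rG (@fib a b B X) f2 _ _) => [j y|i z].
  by rewrite /= fibk_tc.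
by rewrite /= fib_single.
Qed.
Definition phi : {linear P2_mod {ffun 'I_a -> X} -> G_mod} := linof phi_linear.

Lemma phiE y x q :
  phi (rep_in (rho := rP2 V fW {ffun 'I_a -> X}) (y, (x, q))) =
  rep_in (rho := rG) (fib B y, (x, fibk B q)).
Proof. by []. Qed.

(* The component at [j] is not linear in general, since [b_j] moves [x] into it;
   composing with [E] must kill this contribution. *)
Lemma component_linear (L : lmodType R) (i : {linear L -> G_mod}) j c (E : 'M[K]_(b, c)) :
  (forall x, mxact E (mxact (B j) (i x).2.1) = 0) ->
  linear (fun x : L => rep_in (rho := rM V fW j {ffun 'I_c -> X})
    (mxact E ((i x).1 j), fmap (@mxact K b c E X) ((i x).2.2 j))).
Proof.
move=> E0.
pose f1 : Z -> {ffun 'I_c -> X} := fun y => mxact E (y j).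
pose f2 : {ffun 'I_a -> X} * Zk -> {ffun 'I_k -> {ffun 'I_c -> X}} :=
  fun z => fmap (@mxact K b c E X) (z.2 j).
have l1 : linear f1 by move=> s y y'; rewrite /f1 !ffunE linearP.
have l2 : linear f2 by move=> s y y'; rewrite /f2 !ffunE linearP.
refine (@rep_map_on K n m V W rG (rM V fW j {ffun 'I_c -> X}) L i
  (linof l1) (linof l2) _ _) => [s y|s x].
  by rewrite /= /f1 /f2 /= ffunE fmap_tensor.
rewrite /= /f1 ffunE; case: eqP => [<-|_]; last by rewrite linear0.
exact: E0.
Qed.

End TailRep.

Lemma S_map_linear X1 X2 Y1 Y2 (f : {linear X1 -> Y1}) (g : {linear X2 -> Y2}) :
  linear (fun u : S_mod X1 X2 => rep_in (rho := rS V W Y1 Y2) (f u.1, g u.2)).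
Proof.
by refine (@rep_map K n m V W (rS V W X1 X2) (rS V W Y1 Y2) f g _ _) => j u /=; rewrite linear0.
Qed.

Section TailInclusion.
Variables (a : nat) (T : 'M[K]_(a, n)) (X : lmodType K).
Let B i : 'M[K]_(a, h) := T *m fr_out (fV i).

Fact tail_incl_linear : linear (fun u : G_mod B X =>
  rep_in (rho := rP1 fV fW X) ((0, u.1), (mxact T u.2.1, u.2.2))).
Proof.
refine (@rep_map K n m V W (rG B X) (rP1 fV fW X)
  (pairr X _) (pair_map (@mxact K a n T X) idfun) _ _) => [j y|i z] /=.
  by rewrite !linear0.
by rewrite mxactM.
Qed.
(* The inclusion of [G_mod (T D) X] in [R e_1 (x) X] when [T] is injective. *)
Definition tail_incl : {linear G_mod B X -> P1_mod X} := linof tail_incl_linear.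
End TailInclusion.

Section Covers.
Variable X : lmodType K.

(** This is right multiplication by [b_i]. It kills every [b_j c] because [b_j c b_i = 0]; in the
    span of the [c_j] its kernel is [W_i]. *)
Fact coverM_linear i : linear (fun u : P1_mod X =>
  rep_in (rho := rM V fW i X) (u.1.1, mxact (fr_out (fW i)) u.2.1)).
Proof.
refine (@rep_map K n m V W (rP1 fV fW X) (rM V fW i X)
  (pfst X _) (@mxact K n k (fr_out (fW i)) X \o pfst _ _) _ _) => [j u|j u] //=.
by rewrite -mxact_single.
Qed.
Definition coverM i : {linear P1_mod X -> M_mod i X} := linof (coverM_linear i).

Variable O : lmodType K.

Fact coverS1_linear : linear (fun u : P1_mod X => rep_in (rho := rS V W X O) (u.1.1, 0)).
Proof.
by refine (@rep_map K n m V W (rP1 fV fW X) (rS V W X O) (pfst X _) \0 _ _).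
Qed.
Definition coverS1 : {linear P1_mod X -> S_mod X O} := linof coverS1_linear.

Fact coverS2_linear : linear (fun u : P2_mod X => rep_in (rho := rS V W O X) (0, u.2.1)).
Proof.
by refine (@rep_map K n m V W (rP2 V fW X) (rS V W O X) \0 (pfst X _) _ _).
Qed.
Definition coverS2 : {linear P2_mod X -> S_mod O X} := linof coverS2_linear.
End Covers.

End TailModules.

(** For [d <= 1] the module is projective, and the kernel of a cover is then known to be projective
    but not to be zero; hence the maximum with [1]. *)
Lemma pdx_kerE_max (R : pzRingType) d (P M : lmodType R) (f : {linear P -> M}) :
  projective P -> onto f -> pdx d M -> pdx (maxn 1 d.-1) (ker_mod f).
Proof.
move=> pP fs pM; have [d2|d2] := ltnP 1 d.
  case: d d2 pM => [|[|d]] //= _ pM; rewrite (maxn_idPr _) //.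
  exact: pdx_kerE pM.
rewrite (maxn_idPl _); first by apply: (pdx_kerE pP fs); apply: pdx_leq pM; apply: leqW.
by case: d d2 {pM} => [|[|]].
Qed.

Section FmapTheory.
Variable K : fieldType.
Implicit Types X : lmodType K.

Lemma fmap_mxactM s a b c (B : 'M[K]_(a, b)) (C : 'M[K]_(b, c)) X
    (q : {ffun 'I_s -> {ffun 'I_a -> X}}) :
  fmap (@mxact K b c C X) (fmap (@mxact K a b B X) q) = fmap (@mxact K a c (B *m C) X) q.
Proof. by apply/ffunP => t; rewrite !ffunE mxactM. Qed.

Lemma fmap_mxact1 s a X (q : {ffun 'I_s -> {ffun 'I_a -> X}}) :
  fmap (@mxact K a a 1%:M X) q = q.
Proof. by apply/ffunP => t; rewrite ffunE mxact1. Qed.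

Lemma fmap_mxact0 s a b X (q : {ffun 'I_s -> {ffun 'I_a -> X}}) :
  fmap (@mxact K a b 0 X) q = 0.
Proof. by apply/ffunP => t; rewrite !ffunE mxact0. Qed.

Lemma kret_eq0 a b (B : 'M[K]_(a, b)) X (y : {ffun 'I_a -> X}) :
  mxact B y = 0 -> mxact (kret B) y = 0 -> y = 0.
Proof.
move=> y1 y2; have [H HE] := kmx_split B.
by rewrite -[y]mxact1 -HE mxactDl -(mxactM (kret B)) -(mxactM B) y1 y2 !linear0 addr0.
Qed.

Lemma fmap_kret_eq0 s a b (B : 'M[K]_(a, b)) X (q : {ffun 'I_s -> {ffun 'I_a -> X}}) :
  fmap (@mxact K a b B X) q = 0 -> fmap (@mxact K _ _ (kret B) X) q = 0 -> q = 0.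
Proof.
move=> /ffunP q1 /ffunP q2; apply/ffunP => t; rewrite [RHS]ffunE; apply: (kret_eq0 (B := B)).
  by have := q1 t; rewrite !ffunE.
by have := q2 t; rewrite !ffunE.
Qed.

End FmapTheory.

(** * Contributions of the kernel and the cokernel of [B j] to the projective dimension *)

Section Bounds.
Variables (K : fieldType) (n m k h : nat) (V W : 'I_m -> {vspace 'rV[K]_n}).
Variables (fV : forall i, frame (V i) k h) (fW : forall i, frame (W i) h k).
Local Notation R := (algR V W).
Local Notation tail_c := (tail_c fW).
Local Notation M_mod := (@M_mod K n m k h V W fW).
Local Notation P2_mod := (@P2_mod K n m k h V W fW).
Local Notation phi := (@phi K n m k h V W fW _ _).
Local Notation G_mod := (@G_mod K n m k h V W fW _ _).
Local Notation G_rep := (@rG K n m k h V W fW _ _).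
Implicit Types X Y : lmodType K.

Lemma M_mod0 j s X : (1%:M : 'M[K]_s) = 0 -> forall u : M_mod j {ffun 'I_s -> X}, u = 0.
Proof.
move=> s0 [y q]; have y0 (z : {ffun 'I_s -> X}) : z = 0 by rewrite -[z]mxact1 s0 mxact0.
by congr (_, _); [exact: y0|apply/ffunP => t; rewrite (y0 (q t)) ffunE].
Qed.

Lemma tail_c_singleE j i Y (y : Y) : tail_c j (single i y) = single i (tensor (row j (fr_out (fW i))) y).
Proof. by apply/ffunP => i'; rewrite !ffunE; case: eqP => [->//|_]; rewrite linear0. Qed.

Section Tails.
Variables (a b : nat) (B : 'I_m -> 'M[K]_(a, b)) (X : lmodType K).

Lemma phi_eq0 u : phi B X u = 0 <->
  [/\ u.2.1 = 0, forall j, mxact (B j) (u.1 j) = 0 &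
      forall j, fmap (@mxact K a b (B j) X) (u.2.2 j) = 0].
Proof.
case: u => y [x q]; rewrite [phi _ _ _]phiE; split.
  move=> [/ffunP y0 x0 /ffunP q0]; split=> // j.
    by have := y0 j; rewrite !ffunE.
  by have := q0 j; rewrite !ffunE.
move=> /= [-> y0 q0]; congr (_, (_, _)); apply/ffunP => j; rewrite !ffunE.
  exact: y0.
exact: q0.
Qed.

Fact insert_linear j c (E : 'M[K]_(c, a)) : linear (fun u : M_mod j {ffun 'I_c -> X} =>
  rep_in (rho := rP2 V fW {ffun 'I_a -> X})
    (single j (mxact E u.1), (0, single j (fmap (@mxact K c a E X) u.2)))).
Proof.
pose f1 := @single K m j {ffun 'I_a -> X} \o @mxact K c a E X.
pose f2 := @single K m j {ffun 'I_k -> {ffun 'I_a -> X}} \o @fmap K k _ _ (@mxact K c a E X).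
refine (@rep_map K n m V W (rM V fW j {ffun 'I_c -> X}) (rP2 V fW {ffun 'I_a -> X})
  f1 (pairr {ffun 'I_a -> X} _ \o f2) _ _) => [s y|s z] /=.
  by rewrite tail_c_singleE fmap_tensor.
by rewrite !linear0.
Qed.
Definition insert j c (E : 'M[K]_(c, a)) :
  {linear M_mod j {ffun 'I_c -> X} -> P2_mod {ffun 'I_a -> X}} := linof (@insert_linear j c E).

Lemma phi_insert j c (E : 'M[K]_(c, a)) u : E *m B j = 0 -> phi B X (insert j E u) = 0.
Proof.
move=> E0; apply/phi_eq0; split=> // j'; rewrite /= !ffunE; case: eqP => [->|_];
  rewrite ?linear0 //.
  by rewrite mxactM E0 mxact0.
by rewrite fmap_mxactM E0 fmap_mxact0.
Qed.

End Tails.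

Lemma component_P2 a X (L : lmodType R) (i : {linear L -> P2_mod {ffun 'I_a -> X}}) j c
    (E : 'M[K]_(a, c)) : (forall x, (i x).2.1 = 0) ->
  exists f : {linear L -> M_mod j {ffun 'I_c -> X}}, forall x,
    f x = rep_in (rho := rM V fW j {ffun 'I_c -> X})
      (mxact E ((i x).1 j), fmap (@mxact K a c E X) ((i x).2.2 j)).
Proof.
move=> i0; pose i' := phi (fun=> 1%:M : 'M[K]_a) X \o i.
have E0 x : mxact E (mxact 1%:M (i' x).2.1) = 0.
  by rewrite mxactM mul1mx [(i' x).2.1](i0 x) linear0.
exists (linof (@component_linear K n m k h V W fW _ _ _ _ _ i' j c E E0)) => x.
rewrite linofE; congr (rep_in (_, _)); rewrite /= ffunE; first by rewrite mxact1.
by rewrite fmap_mxact1.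
Qed.

(* The kernel of [phi] is the direct sum of the [R b_j (x) ker (B j)]. *)
Lemma ker_ub a b (B : 'I_m -> 'M[K]_(a, b)) X (L : lmodType R)
    (i : {linear L -> P2_mod {ffun 'I_a -> X}}) d :
  injective i -> (forall u, (exists x, i x = u) <-> phi B X u = 0) ->
  (forall j, (forall Y, pdx d (M_mod j Y)) \/ exists C, B j *m C = 1%:M) ->
  pdx d L.
Proof.
move=> ii iE pM.
have iL x : phi B X (i x) = 0 by apply/iE; exists x.
have i0 x : (i x).2.1 = 0 by have /phi_eq0[] := iL x.
have f_ex j := component_P2 j (kret (B j)) i0.
pose f j := sval (cid (f_ex j)); have fE j := svalP (cid (f_ex j)) : forall x, f j x = _.
have kB (j : 'I_m) : pdx d (M_mod j {ffun 'I_(\rank (kermx (B j))) -> X}).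
  (* A right inverse of [B j] makes its left kernel zero, so the multiplicity space of [R b_j] is
     zero. *)
  case: (pM j) => [//|[C BC]]; apply/pdx0/M_mod0.
  by rewrite -(kmxK (B j)) -[kmx (B j)]mulmx1 -BC mulmxA kmx_mul !mul0mx.
apply: (@pdx_filtration _ _ (enum 'I_m) d L (ker_mod (idfun : {linear L -> L})) _ f
  (ker_incl _)) => //.
- exact: enum_uniq.
- exact: ker_inj.
- move=> x; split=> [[y <-] j _|fx0].
    by rewrite (_ : ker_incl _ y = 0) ?linear0 //; exact: (ker_inclP y).
  exists 0; rewrite linear0; apply/esym/ii; rewrite linear0.
  have /phi_eq0[x0 y0 q0] := iL x.
  have yq j : (i x).1 j = 0 /\ (i x).2.2 j = 0.
    have := fx0 j (mem_enum _ _); rewrite fE => -[e1 e2].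
    by split; [exact: kret_eq0 (y0 j) e1|exact: fmap_kret_eq0 (q0 j) e2].
  case: (i x) x0 yq => y [x1 q] /= -> yq; congr (_, (_, _)); apply/ffunP => j;
    rewrite [RHS]ffunE; by case: (yq j).
- move=> j u _; have /iE[x xE] : phi B X (insert X j (kmx (B j)) u) = 0.
    by apply: phi_insert; exact: kmx_mul.
  exists x; split=> [|j' _ jj']; rewrite fE xE /= !ffunE.
    by rewrite eqxx mxactM fmap_mxactM kmxK mxact1 fmap_mxact1; case: u {xE}.
  by rewrite (negbTE jj') !linear0.
- by apply: pdx0 => x; apply: ker_inj; rewrite linear0; exact: (ker_inclP x).
Qed.

Section TailModule.
Variables (a b : nat) (B : 'I_m -> 'M[K]_(a, b)) (X : lmodType K).
Local Notation G := (G_mod B X).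
Local Notation P := (P2_mod {ffun 'I_a -> X}).
Let S j : 'M[K]_b := cmx (B j) *m csec (B j).

(* [sigma] is idempotent and its kernel is the image of [phi], which is thus a
   direct summand of [G]; the complement is the sum of the
   [R b_j (x) coker (B j)]. *)
Fact sigma_linear : linear (fun u : G =>
  rep_in (rho := G_rep B X) (fib S u.1, (0, fibk S u.2.2))).
Proof.
pose f2 := pair_map (\0 : {linear {ffun 'I_a -> X} -> {ffun 'I_a -> X}})
  (linof (@fibk_linear K m k b b S X)).
refine (@rep_map K n m V W (G_rep B X) (G_rep B X) (@fib K m b b S X) f2 _ _) => [j y|i z] /=.
  by rewrite fibk_tc.
by rewrite fib_single mxactM mulmxA cmx_mul mul0mx mxact0 !linear0.
Qed.
Let sigma : {linear G -> G} := linof sigma_linear.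

Let sigma_phi u : sigma (phi B X u) = 0.
Proof.
case: u => y [x q]; congr (_, (_, _)); apply/ffunP => j; rewrite /= !ffunE.
  by rewrite mxactM mulmxA cmx_mul mul0mx mxact0.
by rewrite fmap_mxactM mulmxA cmx_mul mul0mx fmap_mxact0.
Qed.

Let sigma_idem u : sigma (sigma u) = sigma u.
Proof.
have SS j : S j *m S j = S j by rewrite /S mulmxA -(mulmxA (cmx _)) cmxK mulmx1.
case: u => y [x q]; congr (_, (_, _)); apply/ffunP => j; rewrite /= !ffunE.
  by rewrite mxactM SS.
by rewrite fmap_mxactM SS.
Qed.

Lemma image_cover : exists f : {linear P -> ker_mod sigma},
  onto f /\ forall u, f u = 0 <-> phi B X u = 0.
Proof.
have [f fE] := ker_corestr sigma_phi; exists f; split=> [v|u]; last first.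
  by rewrite -fE -(linear0 (ker_incl sigma)); split=> [->|/ker_inj].
(* On the kernel of [S j] the identity [cmx csec + H B = 1] reduces to [H B = 1], so [H] supplies
   preimages under [phi]. *)
have HE := fun j => svalP (cid (cmx_split (B j))).
set H := fun j => sval (cid (cmx_split (B j))) in HE.
have := ker_inclP v; case vE : (ker_incl sigma v) => [y [x q]] [/ffunP y0 /ffunP q0].
exists (rep_in (rho := rP2 V fW _) (fib H y, (x, fibk H q))).
apply: ker_inj; rewrite fE vE [phi _ _ _]phiE; congr (_, (_, _)); apply/ffunP => j.
  have := y0 j; rewrite !ffunE => yj.
  by rewrite -[RHS]mxact1 -(HE j) mxactDl -/(S j) yj add0r mxactM.
have := q0 j; rewrite !ffunE => qj; rewrite fmap_mxactM; apply/ffunP => t.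
have := congr1 (fun g : {ffun _ -> _} => g t) qj; rewrite !ffunE => qt.
by rewrite -[RHS]mxact1 -(HE j) mxactDl -/(S j) qt add0r.
Qed.

(** [G] is an extension of the [R b_j (x) coker (B j)] by the image of [phi], whose cover by [R e_2]
    has kernel the sum of the [R b_j (x) ker (B j)]. An invertible [B j] contributes to neither. *)
Lemma G_ub d :
  (forall j, (forall Y, pdx d (M_mod j Y)) \/
     exists C, B j *m C = 1%:M /\ C *m B j = 1%:M) ->
  pdx d.+1 G.
Proof.
move=> pM; have [f [fo fE]] := image_cover.
have pN : pdx d.+1 (ker_mod sigma).
  apply: (pdx_cover (@rP2_projective _ _ _ _ _ _ _ fW _) fo).
  apply: (ker_ub (B := B) (@ker_inj _ _ _ f)) => [u|j].
    rewrite -fE; split=> [[x <-]|]; [exact: ker_inclP|exact: ker_lift].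
  by case: (pM j) => [?|[C []]]; [left|right; exists C].
(* The contribution of [b_j] lies in the image of [B j], so it dies in the cokernel and the
   component map is linear on all of [G]. *)
have c0 j (x : G) : mxact (cmx (B j)) (mxact (B j) (idfun x : G).2.1) = 0.
  by rewrite mxactM cmx_mul mxact0.
pose g j : {linear G -> M_mod j {ffun 'I_(\rank (kermx (B j)^T)) -> X}} :=
  linof (@component_linear K n m k h V W fW _ _ _ _ G idfun j _ _ (c0 j)).
apply: (@pdx_filtration _ _ (enum 'I_m) d.+1 G _ _ g (ker_incl sigma)) => //.
- exact: enum_uniq.
- exact: ker_inj.
- move=> u; have -> : (exists v, ker_incl sigma v = u) <-> sigma u = 0.
    by split=> [[x <-]|]; [exact: ker_inclP|exact: ker_lift].
  case: u => y [x q]; split.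
    move=> [/ffunP y0 /ffunP q0] j _; congr (_, _) => /=.
      have := y0 j; rewrite !ffunE => /(congr1 (@mxact K _ _ (cmx (B j)) X)).
      by rewrite mxactM -mulmxA cmxK mulmx1 linear0.
    have := q0 j; rewrite !ffunE => /(congr1 (fmap (@mxact K _ _ (cmx (B j)) X))).
    by rewrite fmap_mxactM -mulmxA cmxK mulmx1 linear0.
  move=> g0; congr (_, (_, _)); apply/ffunP => j; have [/= y0 q0] := g0 j (mem_enum _ _).
    by rewrite !ffunE /S -mxactM y0 linear0.
  by rewrite !ffunE /S -fmap_mxactM q0 linear0.
- move=> j [y q] _.
  exists (rep_in (rho := G_rep B X)
    (single j (mxact (csec (B j)) y), (0, single j (fmap (@mxact K _ _ (csec (B j)) X) q)))).
  split=> [|j' _ jj']; congr (_, _); rewrite /= !ffunE.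
  + by rewrite eqxx mxactM cmxK mxact1.
  + by rewrite eqxx fmap_mxactM cmxK fmap_mxact1.
  + by rewrite (negbTE jj') linear0.
  + by rewrite (negbTE jj') linear0.
- move=> j _; case: (pM j) => [pj|[C [_ CB]]]; first exact: pdxS.
  apply/pdx0/M_mod0; rewrite -(cmxK (B j)) -[cmx (B j)]mul1mx -CB.
  by rewrite -!mulmxA cmx_mul !mulmx0.
Qed.

(** A single vector [x] of the kernel embeds [R b_j (x) X] in the kernel of the cover of the image
    of [phi], and [x'] splits the embedding. That image is itself a retract of [G], by
    [1 - sigma]. *)
Lemma G_lb d j (x : 'rV[K]_a) (x' : 'cV[K]_a) :
  x *m x' = 1%:M -> x *m B j = 0 -> pdx d G ->
  pdx (maxn 1 d.-1) (M_mod j {ffun 'I_1 -> X}).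
Proof.
move=> xx xB pG; have [f [fo fE]] := image_cover.
have [|r rE] := @ker_corestr _ _ _ sigma _ (idfun \- sigma).
  by move=> u; rewrite linearB [sigma (sigma u)]sigma_idem subrr.
have pN : pdx d (ker_mod sigma).
  apply: (pdx_retract (i := ker_incl sigma) (r := r)) pG => u.
  apply: ker_inj; rewrite rE.
  by rewrite [LHS](_ : _ = ker_incl sigma u - sigma (ker_incl sigma u)) // ker_inclP subr0.
have pL := pdx_kerE_max (@rP2_projective _ _ _ _ _ _ _ fW _) fo pN.
have [|i iE] := @ker_corestr _ _ _ f _ (insert X j x).
  by move=> u; apply/fE; exact: phi_insert.
have L0 (v : ker_mod f) : (ker_incl f v).2.1 = 0.
  by have /fE/phi_eq0[] := ker_inclP v.
have [g gE] := component_P2 j x' L0.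
apply: (pdx_retract (i := i) (r := g)) pL => u.
rewrite gE iE /= !ffunE eqxx mxactM fmap_mxactM xx mxact1 fmap_mxact1.
by case: u.
Qed.

End TailModule.
End Bounds.

(** * Projective dimension of the [R b_i] and of the simple modules *)

Section ModuleDimensions.
Variables (K : fieldType) (n m k h : nat) (V W : 'I_m -> {vspace 'rV[K]_n}).
Variables (fV : forall i, frame (V i) k h) (fW : forall i, frame (W i) h k).
Local Notation R := (algR V W).
Local Notation M_mod := (@M_mod K n m k h V W fW).
Local Notation P1_mod := (@P1_mod K n m k h V W fV fW).
Local Notation P2_mod := (@P2_mod K n m k h V W fW).
Local Notation S_mod := (@S_mod K n m V W).
Local Notation G_mod := (@G_mod K n m k h V W fW _ _).
Local Notation coverM := (@coverM K n m k h V W fV fW).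
Local Notation coverS1 := (@coverS1 K n m k h V W fV fW).
Local Notation coverS2 := (@coverS2 K n m k h V W fW).
Local Notation tail_incl := (@tail_incl K n m k h V W fV fW).
Local Notation phi := (@phi K n m k h V W fW _ _).
Implicit Types X Y : lmodType K.

(** The map from [W_i] to [C / V_j] is injective, and it is square because [dim W_i = codim V_j]. *)
Lemma tdim0_inverse i j : tdim V W j i = 0%N ->
  exists C, fr_in (fW i) *m fr_out (fV j) *m C = 1%:M /\
            C *m (fr_in (fW i) *m fr_out (fV j)) = 1%:M.
Proof.
move=> t0; set B := _ *m _.
have Bu : B \in unitmx.
  rewrite -row_free_unit; apply: inj_row_free => v vB.
  have vV : v *m fr_in (fW i) \in V j by rewrite (fr_mem (fV j)) -mulmxA vB.
  have vW : v *m fr_in (fW i) \in W i.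
    by rewrite (fr_mem (fW i)) -mulmxA fr_in_out mulmx0.
  have : v *m fr_in (fW i) \in (V j :&: W i)%VS by rewrite memv_cap vV.
  move/eqP: t0; rewrite /tdim dimv_eq0 => /eqP ->; rewrite memv0 => /eqP v0.
  by rewrite -[v]mulmx1 -(fr_inK (fW i)) mulmxA v0 mul0mx.
by exists (invmx B); rewrite mulmxV // mulVmx.
Qed.

Lemma row_right_inverse a (x : 'rV[K]_a) : x != 0 -> exists x', x *m x' = 1%:M.
Proof.
by move=> x0; exists (pinvmx x); apply: mulmxVp; rewrite /row_free rank_rV x0.
Qed.

(** The vector [x] consists of the coordinates, in the basis of [W i], of a nonzero vector common to
    [V j] and [W i]. *)
Lemma tdim_gt0_kernel i j : (0 < tdim V W j i)%N ->
  exists (x : 'rV[K]_h) x', x *m x' = 1%:M /\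
    x *m (fr_in (fW i) *m fr_out (fV j)) = 0.
Proof.
rewrite lt0n /tdim dimv_eq0 => ne.
have := memv_pick (V j :&: W i)%VS; have := vpick0 (V j :&: W i)%VS.
rewrite (negbTE ne); set u := vpick _ => u0.
rewrite memv_cap (fr_mem (fV j)) (fr_mem (fW i)) => /andP[/eqP uD /eqP uA].
have uE : u = u *m fr_ret (fW i) *m fr_in (fW i).
  by rewrite -[LHS]mulmx1 -(fr_split (fW i)) mulmxDr !mulmxA uA mul0mx addr0.
have [|x' xx'] := @row_right_inverse _ (u *m fr_ret (fW i)).
  by apply: contraFneq u0 => e; rewrite uE e mul0mx.
by exists (u *m fr_ret (fW i)), x'; split=> //; rewrite mulmxA -uE.
Qed.

(** For the syzygy of [S_1] the relevant map is [C -> C / V_j]. Its kernel [V_j] is nonzero for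
    every [j], so all the [R b_j] occur in the second syzygy. *)
Lemma V_kernel j : (0 < k)%N -> exists (x : 'rV[K]_n) x', x *m x' = 1%:M /\
  x *m (1%:M *m fr_out (fV j)) = 0.
Proof.
move=> k0; pose t := Ordinal k0.
have [|x' xx'] := @row_right_inverse _ (row t (fr_in (fV j))).
  apply/negP => /eqP e; have /rowP/(_ t) := congr1 (fun z => z *m fr_ret (fV j)) e.
  by rewrite -row_mul fr_inK mul0mx !mxE eqxx => /eqP; rewrite oner_eq0.
exists (row t (fr_in (fV j))), x'; split=> //.
by rewrite mul1mx -row_mul fr_in_out row0.
Qed.

Lemma coverM_ses X i : ses (tail_incl (fr_in (fW i)) X) (coverM X i).
Proof.
split.
- apply: linear_inj0 => -[y [x q]] [/= y0 x0 q0]; congr (_, (_, _)) => //.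
  by rewrite -[x]mxact1 -(fr_inK (fW i)) -mxactM x0 linear0.
- move=> [x z]; exists (rep_in (rho := rP1 fV fW X) ((x, 0), (mxact (fr_sec (fW i)) z, 0))).
  by congr (_, _); rewrite /= mxactM fr_secK mxact1.
move=> [[x y] [z q]]; split=> [[/= -> z0]|[[y' [x' q']] [<- <- <- <-]]].
  exists (rep_in (rho := rG V fW (fun j => fr_in (fW i) *m fr_out (fV j)) X)
    (y, (mxact (fr_ret (fW i)) z, q))).
  congr ((_, _), (_, _)) => /=.
  rewrite -[RHS]mxact1 -(fr_split (fW i)) mxactDl -(mxactM (fr_out _)) z0 linear0 addr0.
  by rewrite mxactM.
by congr (_, _); rewrite /= mxactM fr_in_out mxact0.
Qed.

(** One unit comes from the cover by [R e_1], the other from the cover of [N_i] by [R e_2]. Indices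
    with [t_ji = 0] need no bound, as their matrix is invertible. *)
Lemma M_ub i d :
  (forall j, (forall Y, pdx d (M_mod j Y)) \/ tdim V W j i = 0%N) ->
  forall X, pdx d.+2 (M_mod i X).
Proof.
move=> pM X; have [_ co _] := coverM_ses X i.
apply: (pdx_cover (@rP1_projective _ _ _ _ _ _ _ fV fW X) co).
apply/(pdx_ker _ (coverM_ses X i)); apply: G_ub => j.
by case: (pM j) => [?|/tdim0_inverse]; [left|right].
Qed.

Section SimpleCovers.
Variable O : lmodType K.
Hypothesis O0 : forall x : O, x = 0.

Lemma coverS1_ses X : ses (tail_incl 1%:M X) (coverS1 X O).
Proof.
split.
- apply: linear_inj0 => -[y [x q]] [/= y0 x0 q0]; congr (_, (_, _)) => //.
  by rewrite -[x]mxact1 x0.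
- move=> [x z]; exists (rep_in (rho := rP1 fV fW X) ((x, 0), (0, 0))).
  by congr (_, _); rewrite [z]O0.
move=> [[x y] [z q]]; split=> [[/= ->]|[[y' [x' q']] [<- <- <- <-]] //].
exists (rep_in (rho := rG V fW (fun j => 1%:M *m fr_out (fV j)) X) (y, (z, q))).
by congr ((_, _), (_, _)) => /=; rewrite mxact1.
Qed.

Lemma coverS2_onto X : onto (coverS2 X O).
Proof.
move=> [z x]; exists (rep_in (rho := rP2 V fW X) (0, (x, 0))).
by congr (_, _); rewrite [z]O0.
Qed.

Lemma S1_ub d X : (forall j Y, pdx d (M_mod j Y)) -> pdx d.+2 (S_mod X O).
Proof.
move=> pM; have [_ co _] := coverS1_ses X.
apply: (pdx_cover (@rP1_projective _ _ _ _ _ _ _ fV fW X) co).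
by apply/(pdx_ker _ (coverS1_ses X)); apply: G_ub => j; left.
Qed.

Lemma S2_ub d X : (forall j Y, pdx d (M_mod j Y)) -> pdx d.+1 (S_mod O X).
Proof.
(* The lemma [ker_ub] expects multiplicities of the form [{ffun 'I_a -> X}]; so [a = 1] is used, and
   [X] is recovered as a retract. With matrices of size [1] by [0] the kernel of [phi] is the whole
   radical of [R e_2]. *)
move=> pM; pose X1 := {ffun 'I_1 -> X}.
have pX1 : pdx d.+1 (S_mod O X1).
  apply: (pdx_cover (@rP2_projective _ _ _ _ _ _ _ fW X1) (@coverS2_onto X1)).
  apply: (ker_ub (B := fun=> 0 : 'M[K]_(1, 0)) (@ker_inj _ _ _ (coverS2 X1 O))) => [u|j].
    rewrite phi_eq0; split=> [[x <-]|[u0 _ _]].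
      have [e] := ker_inclP x; split=> // j; last exact: fmap_mxact0.
      exact: mxact0.
    by apply: ker_lift; congr (_, _).
  by left.
have ol : linear (fun y : X1 => y ord0) by move=> c y y'; rewrite !ffunE.
pose i := linof (@S_map_linear K n m V W _ _ _ _ (idfun : {linear O -> O}) (@single K 1 ord0 X)).
pose r := linof (@S_map_linear K n m V W _ _ _ _ (idfun : {linear O -> O}) (linof ol)).
apply: (@pdx_retract _ d.+1 (S_mod O X1) (S_mod O X) i r) pX1 => -[z x].
by congr (_, _); rewrite /= ffunE.
Qed.

Lemma S_ub d X1 X2 : (forall j Y, pdx d (M_mod j Y)) -> pdx d.+2 (S_mod X1 X2).
Proof.
move=> pM.
apply: (@pdx_ext _ _ (S_mod O X2) (S_mod X1 X2) (S_mod X1 O)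
  (linof (@S_map_linear K n m V W _ _ _ _ (\0 : {linear O -> X1}) (idfun : {linear X2 -> X2})))
  (linof (@S_map_linear K n m V W _ _ _ _ (idfun : {linear X1 -> X1}) (\0 : {linear X2 -> O})))).
- split.
  + by apply: linear_inj0 => -[z x] [/= x0]; congr (_, _); rewrite ?x0 // [z]O0.
  + by move=> [x z]; exists (rep_in (rho := rS V W X1 X2) (x, 0)); congr (_, _); rewrite [z]O0.
  + move=> [x1 x2]; split=> [[/= ->]|[[z x] [<- _]] //].
    by exists (rep_in (rho := rS V W O X2) (0, x2)).
- exact/pdxS/S2_ub.
- exact: S1_ub.
Qed.

Lemma S1_lb d X : (0 < k)%N -> pdx d (S_mod X O) ->
  forall j, pdx (maxn 1 d.-2) (M_mod j {ffun 'I_1 -> X}).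
Proof.
move=> k0 pS j; have [_ co _] := coverS1_ses X.
have := pdx_kerE_max (@rP1_projective _ _ _ _ _ _ _ fV fW X) co pS.
move=> /(pdx_ker _ (coverS1_ses X)) pG.
have [x [x' [xx xB]]] := V_kernel j k0.
apply: pdx_leq (G_lb xx xB pG).
by case: d {pS pG} => [|[|[|d]]].
Qed.

End SimpleCovers.

(** A section of the cover would send [b_i (x) x0] to an element whose [e_1]-coefficient is [x0]. A
    nonzero [w] in [W_i] kills the former, but sends the latter to an element with the nonzero term
    [w (x) x0]. *)
Lemma M_not_projective i X (x0 : X) : (0 < h)%N -> x0 <> 0 -> ~ projective (M_mod i X).
Proof.
move=> h0 x00 pM; have [_ co _] := coverM_ses X i.
have [s sK] := projective_split pM co.
pose w := row (Ordinal h0) (fr_in (fW i)).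
have wA : w *m fr_out (fW i) = 0 by rewrite -row_mul fr_in_out row0.
pose u : M_mod i X := rep_in (rho := rM V fW i X) (x0, 0).
have wu : clin V W w *: u = 0.
  by rewrite /u rep_clin tensor_sum wA tensor0.
have := congr1 s wu; rewrite linear0 linearZ /=; have := sK u.
case: (s u) => [[x y] [z q]] [/= -> _]; rewrite [X in X = _ -> _]rep_clin.
rewrite /= pair_sum => -[+ _]; rewrite single_sumE => /ffunP w0.
have /rowP/(_ (Ordinal h0)) : w *m fr_ret (fW i) = 0.
  suff -> : w = 0 by rewrite mul0mx.
  apply/rowP => j; have := w0 j; rewrite !ffunE => wj; rewrite [RHS]mxE.
  apply/eqP/negPn/negP => wj0; apply: x00.
  by rewrite -[x0](scalerK wj0) wj scaler0.
by rewrite -row_mul fr_inK !mxE eqxx => /eqP; rewrite oner_eq0.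
Qed.

Lemma M_lb i d X (x0 : X) : (0 < h)%N -> x0 <> 0 -> pdx d (M_mod i X) ->
  (1 < d)%N /\ forall j, (0 < tdim V W j i)%N ->
    pdx (maxn 1 d.-2) (M_mod j {ffun 'I_1 -> X}).
Proof.
move=> h0 x00 pM; have d1 : (1 < d)%N.
  rewrite ltnNge; apply/negP => d1.
  by apply: (M_not_projective h0 x00); apply: pdx1_proj; apply: pdx_leq d1 pM.
split=> // j /tdim_gt0_kernel[x [x' [xx xB]]].
have [_ co _] := coverM_ses X i.
have := pdx_kerE_max (@rP1_projective _ _ _ _ _ _ _ fV fW X) co pM.
move=> /(pdx_ker _ (coverM_ses X i)) pG.
apply: pdx_leq (G_lb xx xB pG).
by case: d {pM pG} d1 => [|[|[|d]]].
Qed.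

(* For left modules the arrows of [Gamma] appear reversed: the syzygies of
   [R b_i] involve the [R b_j] with [V_j] and [W_i] not independent. *)
Definition tedge : rel 'I_m := fun i j => (0 < tdim V W j i)%N.

Lemma chain_lb s i d X (x0 : X) : (0 < h)%N -> x0 <> 0 -> path tedge i s ->
  pdx d (M_mod i X) -> (2 * (size s).+1 <= d)%N.
Proof.
move=> h0; elim: s i d X x0 => [|j s IH] i d X x0 x00 /=.
  by move=> _ /(M_lb h0 x00)[].
move=> /andP[ij js] /(M_lb h0 x00)[d1 /(_ j ij) pj].
have x10 : (single ord0 x0 : {ffun 'I_1 -> X}) <> 0.
  by move=> /ffunP/(_ ord0); rewrite !ffunE.
have := IH _ _ _ _ x10 js pj.
(* The left side is at least [2], so the alternative [1] of the maximum is impossible and nothing is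
   lost along the chain. *)
rewrite leq_max [(2 * (size s).+1 <= 1)%N]leqNgt /= mulnS /= => ds.
by rewrite 2!mulnS; case: d d1 {pj} ds => [|[|d]].
Qed.

Lemma chain_ub r i X : (forall s, path tedge i s -> (size s < r)%N) ->
  pdx (2 * r) (M_mod i X).
Proof.
(* For [r = 0] the empty chain already contradicts the hypothesis. *)
elim: r i X => [|r IH] i X H; first by have := H [::] isT.
rewrite mulnS; apply: M_ub => j; case: (posnP (tdim V W j i)) => [|ij]; [by right|left].
by move=> Y; apply: IH => s js; have := H (j :: s); rewrite /= /tedge ij js => /(_ isT).
Qed.

End ModuleDimensions.

(** * Arbitrary modules *)

Section RadicalFiltration.
Variables (K : fieldType) (n m : nat) (V W : 'I_m -> {vspace 'rV[K]_n}).
Local Notation R := (algR V W).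
Local Notation ee := (ee V W).
Local Notation cc := (cc V W).
Local Notation bb := (bb V W).

Definition ar (a : 'I_n + 'I_m) : R := match a with inl j => cc j | inr i => bb i end.

Lemma ee_ar v a : ee v * ar a = ar a \/ ee v * ar a = 0.
Proof.
by case: a v => [j|i] []; rewrite /= ?ee_cc ?ee_bb; [left|right|right|left].
Qed.

Definition radical (N : lmodType R) (x : N) : Prop :=
  exists z : 'I_n + 'I_m -> N, x = \sum_a ar a *: z a.

Definition killed r (N : lmodType R) : Prop :=
  forall (s : r.-tuple ('I_n + 'I_m)) (x : N), foldr (fun a y => ar a *: y) x s = 0.

Lemma radical_ar (N : lmodType R) a (x : N) : radical (ar a *: x).
Proof.
exists (fun b => if b == a then x else 0); rewrite (bigD1 a) //= eqxx big1 ?addr0 //.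
by move=> b /negbTE ->; rewrite scaler0.
Qed.

Lemma radical0 (N : lmodType R) : radical (0 : N).
Proof. by exists (fun=> 0); rewrite big1 // => a _; rewrite scaler0. Qed.

Lemma radicalP (N : lmodType R) c (x y : N) :
  radical x -> radical y -> radical (kk V W c *: x + y).
Proof.
move=> [z ->] [t ->]; exists (fun a => kk V W c *: z a + t a).
rewrite scaler_sumr -big_split; apply: eq_bigr => a _ /=.
by rewrite scalerDr !scalerA kkC.
Qed.

Lemma radicalD (N : lmodType R) (x y : N) : radical x -> radical y -> radical (x + y).
Proof. by move=> rx ry; rewrite -[x]scale1r -(kk1 V W); apply: radicalP. Qed.

Lemma radical_ee (N : lmodType R) v a (x : N) : radical (ee v *: (ar a *: x)).
Proof.
rewrite scalerA; case: (ee_ar v a) => ->; first exact: radical_ar.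
by rewrite scale0r; exact: radical0.
Qed.

(* The quotient of [N] by its radical is semisimple; it is built from vector space
   quotients at the two vertices. *)
Lemma top_quotient (N : lmodType R) :
  exists Y1 Y2 (f : {linear N -> S_mod V W Y1 Y2}),
    onto f /\ forall x, f x = 0 -> radical x.
Proof.
(* The space at the vertex [v] is [N] modulo the elements whose component [e_v x] lies in the
   radical. *)
have quot v : exists (Y : lmodType K) (q : {linear resK N -> Y}),
    onto q /\ forall x, q x = 0 <-> radical (ee v *: (x : N)).
  apply: quotient_space => [|c x y rx ry].
    by rewrite scaler0; exact: radical0.
  by rewrite resK_scaleE scalerDr scalerA -kkC -scalerA; exact: radicalP.
have [Y1 [q1 [o1 E1]]] := quot false; have [Y2 [q2 [o2 E2]]] := quot true.
have q1e (x : N) : q1 (ee false *: x) = q1 x.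
  apply/eqP; rewrite -subr_eq0 -linearB; apply/eqP/E1.
  by rewrite scalerBr scalerA ee_ee subrr; exact: radical0.
have q2e (x : N) : q2 (ee true *: x) = q2 x.
  apply/eqP; rewrite -subr_eq0 -linearB; apply/eqP/E2.
  by rewrite scalerBr scalerA ee_ee subrr; exact: radical0.
have q1e0 (x : N) : q1 (ee true *: x) = 0.
  by apply/E1; rewrite scalerA ee_ee scale0r; exact: radical0.
have q2e0 (x : N) : q2 (ee false *: x) = 0.
  by apply/E2; rewrite scalerA ee_ee scale0r; exact: radical0.
have q1a a (x : N) : q1 (ar a *: x) = 0 by apply/E1/radical_ee.
have q2a a (x : N) : q2 (ar a *: x) = 0 by apply/E2/radical_ee.
have fl : linear (fun x : N => rep_in (rho := rS V W Y1 Y2) (q1 x, q2 x)).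
  apply: linear_on_generators.
  - by move=> x y; rewrite rep_inD -!linearD.
  - move=> c x; rewrite rep_kk; congr (rep_in (_, _)).
      exact: (linearZZ q1 c x).
    exact: (linearZZ q2 c x).
  - by move=> [] x; rewrite rep_ee ?q1e ?q2e ?q1e0 ?q2e0.
  - by move=> j x; rewrite rep_cc (q1a (inl j)) (q2a (inl j)).
  - by move=> i x; rewrite rep_bb (q1a (inr i)) (q2a (inr i)).
exists Y1, Y2, (linof fl); split.
  move=> [y1 y2]; have [x1 x1E] := o1 y1; have [x2 x2E] := o2 y2.
  exists (ee false *: (x1 : N) + ee true *: (x2 : N)).
  by congr (_, _); rewrite linearD ?q1e ?q2e ?q1e0 ?q2e0 ?addr0 ?add0r.
move=> x [/E1 r1 /E2 r2].
by rewrite -[x]scale1r -(eeD V W) scalerDl; exact: radicalD.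
Qed.

Lemma foldr_ar_linear s (N : lmodType R) (x : N) (I : finType) (F : I -> N) :
  x = \sum_i F i ->
  foldr (fun a y => ar a *: y) x s = \sum_i foldr (fun a y => ar a *: y) (F i) s.
Proof. by move=> ->; elim: s => //= a s ->; rewrite scaler_sumr. Qed.

(** Induction on the radical length: the kernel of the map to the semisimple quotient lies in the
    radical, so products of one arrow fewer kill it. *)
Lemma killed_pdx d r (N : lmodType R) :
  (forall Y1 Y2, pdx d (S_mod V W Y1 Y2)) -> killed r N -> pdx d N.
Proof.
move=> pS; elim: r N => [|r IH] N kN.
  by apply: pdx0 => x; exact: (kN [tuple] x).
have [Y1 [Y2 [f [fo fr]]]] := top_quotient N.
apply: (pdx_ext (ses_ker fo)); last exact: pS.
apply: IH => s x; apply: ker_inj; rewrite linear0.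
have -> : ker_incl f (foldr (fun a y => ar a *: y) x s) =
    foldr (fun a y => ar a *: y) (ker_incl f x) s.
  by case: s => s /= _; elim: s => //= a s <-; rewrite linearZ.
have [z zE] := fr _ (ker_inclP x); rewrite (foldr_ar_linear _ zE) big1 // => a _.
by have := kN [tuple of rcons s a] (z a); rewrite /= foldr_rcons.
Qed.

(** A word of four arrows that avoids [cc] and [bb] alternates, and hence contains some [bcb]; the
    words [cbc] of length three may be nonzero. *)
Lemma all_killed4 (N : lmodType R) : killed 4 N.
Proof.
move=> s x; case/tupleP: s => a s; case/tupleP: s => b s; case/tupleP: s => c s.
case/tupleP: s => d s; rewrite (tuple0 s) /= !scalerA.
suff -> : ar a * ar b * ar c * ar d = 0 by rewrite scale0r.
case: b c => [j|i] [j'|i'].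
- by rewrite -(mulrA (ar a)) cc_cc mulr0 mul0r.
- case: d => [j'|i'']; last by rewrite -!mulrA bb_bb !mulr0.
  by case: a => [j''|i'']; [rewrite cc_cc !mul0r|rewrite bb_cc_bb mul0r].
- case: d => [j''|i'']; first by rewrite -!mulrA cc_cc !mulr0.
  by rewrite -!mulrA [bb i * _]mulrA bb_cc_bb mulr0.
- by rewrite -(mulrA (ar a)) bb_bb mulr0 mul0r.
Qed.

End RadicalFiltration.

(** * Global dimension in terms of chains of indices *)

Section GlobalDimensionBounds.
Variables (K : fieldType) (n m k h : nat) (V W : 'I_m -> {vspace 'rV[K]_n}).
Variables (fV : forall i, frame (V i) k h) (fW : forall i, frame (W i) h k).
Local Notation O := 'rV[K]_0.

Let O0 (x : O) : x = 0. Proof. exact: thinmx0. Qed.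

Lemma gl_dim_ub r : (forall i s, path (tedge V W) i s -> (size s < r)%N) ->
  gl_dim_le (algR V W) (2 * r).+1.
Proof.
move=> H; apply/gl_dim_le_pdx => N.
apply: (@killed_pdx _ _ _ _ _ _ 4); last exact: all_killed4.
move=> Y1 Y2; apply: (@S_ub K n m k h V W fV fW O O0 (2 * r) Y1 Y2) => j Y.
exact: (chain_ub fV fW Y (H j)).
Qed.

Lemma gl_dim_lb d i s : (0 < k)%N -> (0 < h)%N -> path (tedge V W) i s ->
  gl_dim_le (algR V W) d -> (2 * size s + 3 <= d)%N.
Proof.
move=> k0 h0 is_ /gl_dim_le_pdx H.
have x0 : (single ord0 (1 : K^o) : {ffun 'I_1 -> K^o}) <> 0.
  by move=> /ffunP/(_ ord0); rewrite !ffunE /= => /eqP; rewrite oner_eq0.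
(* The bound [d] gives [pdx d.+1] for [S_1]; two syzygies leave [d - 1], which [chain_lb] bounds
   below by [2 * (size s + 1)]. *)
have := S1_lb fV fW O0 k0 (H (S_mod V W K^o O)) i.
move=> /(chain_lb fV h0 x0 is_).
rewrite leq_max mulnS /=; case: d {H} => //= d ds.
by rewrite addnC ltnS.
Qed.

End GlobalDimensionBounds.

(** * Paths in the quiver Gamma *)

Section QuiverPaths.
Variable Q : quiver.
Implicit Types (x : vertex Q) (w : seq (arrow Q)).

Definition mk_path x w (hw : is_walk x w) : qpath Q :=
  QPath (hw : is_walk (x, w).1 (x, w).2).

Lemma walk_end_take x w i : (i <= size w)%N ->
  walk_end x (take i w) = nth x (x :: map (@tgt Q) w) i.
Proof.
by move=> iw; rewrite /walk_end (last_nth x) size_map size_takel // map_take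
  -[x :: take i _]/(take i.+1 (x :: map _ w)) nth_take.
Qed.

(** Pigeonhole: a longer path visits some vertex twice, and the stretch between the two visits is an
    oriented cycle. *)
Lemma acyclic_plength : acyclic Q -> forall p : qpath Q, (plength p < #|vertex Q|)%N.
Proof.
move=> ac p; rewrite ltnNge; apply/negP => pN.
set x := psrc p; set w := parrows p.
have ww : is_walk x w by rewrite /x /w; case: (p).
have : ~~ uniq (x :: map (@tgt Q) w).
  apply/negP => /card_uniqP /=; rewrite size_map => e.
  by have := max_card (mem (x :: map (@tgt Q) w)); rewrite e ltnNge pN.
move=> /(uniqPn x)[i [j [ij]]]; rewrite /= size_map ltnS => jw.
have iw : (i <= size w)%N by apply: leq_trans jw; exact: ltnW.
rewrite -!walk_end_take //.
have jE : take j w = take i w ++ take (j - i) (drop i w).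
  by rewrite -{1}(subnKC (ltnW ij)) takeD.
rewrite jE walk_end_cat => eq_ends.
have ww' : is_walk (walk_end x (take i w)) (take (j - i) (drop i w)).
  move: ww; rewrite -{1}(cat_take_drop j w) is_walk_cat jE is_walk_cat.
  by case/andP => /andP[].
apply: (ac (mk_path ww')); last exact: eq_ends.
rewrite /plength /= size_takel ?subn_gt0 // size_drop.
by rewrite leq_sub2r.
Qed.

(** Go round a cycle [N] times. *)
Lemma not_acyclic_long N : ~ acyclic Q -> exists p : qpath Q, (N <= plength p)%N.
Proof.
move=> nac; apply: contrapT => nN; apply: nac => p p0 pE; apply: nN.
have wk : is_walk (psrc p) (parrows p) by case: (p).
suff [w [hw we sw]] : exists w, [/\ is_walk (psrc p) w,
    walk_end (psrc p) w = psrc p & (N <= size w)%N] by exists (mk_path hw).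
elim: N => [|N [w [hw we sw]]]; first by exists [::].
exists (parrows p ++ w); split.
- by rewrite is_walk_cat wk -/(ptgt p) -pE.
- by rewrite walk_end_cat -/(ptgt p) -pE.
- by rewrite size_cat -add1n leq_add.
Qed.

Lemma acyclic_max_path (v : vertex Q) : acyclic Q -> exists l, max_path_length Q l.
Proof.
move=> ac; pose P l := `[< exists p : qpath Q, plength p = l >].
have exP : exists l, P l by exists 0%N; apply/asboolP; exists (idpath v).
have bP l : P l -> (l <= #|vertex Q|)%N.
  by move=> /asboolP[p <-]; exact/ltnW/acyclic_plength.
case: (ex_maxnP exP bP) => l /asboolP pl lmax; exists l; split=> // p.
by apply: lmax; apply/asboolP; exists p.
Qed.

End QuiverPaths.

(** * Paths of the quiver against chains of indices *)

Section Gamma.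
Variables (K : fieldType) (n m : nat) (V W : 'I_m -> {vspace 'rV[K]_n}).
Local Notation Gamma := (quiverGamma V W).

Let gedge : rel 'I_m := fun i j => tedge V W j i.

Lemma gedge_path i s : path gedge i s ->
  exists i' s', path (tedge V W) i' s' /\ size s' = size s.
Proof.
move=> is_; exists (last i s), (rev (belast i s)).
by rewrite rev_path size_rev size_belast.
Qed.

Lemma tedge_path i s : path (tedge V W) i s ->
  exists i' s', path gedge i' s' /\ size s' = size s.
Proof.
move=> is_; exists (last i s), (rev (belast i s)).
by rewrite size_rev size_belast rev_path.
Qed.

(** Each edge is realised by the detour [b_i -> v_i -> b_j], of length two instead of one, and a
    last arrow [b -> v] gives the extra [1]. *)
Lemma gedge_walk i s : path gedge i s ->
  exists w, is_walk (inl i : vertex Gamma) w /\ size w = (2 * size s).+1.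
Proof.
elim: s i => [|j s IH] i /=; first by exists [:: inl i]; rewrite /= eqxx.
move=> /andP[ij /IH[w [hw sw]]].
pose t : tarrow V W := existT (fun ij => 'I_(tdim V W ij.1 ij.2)) (i, j) (Ordinal ij).
exists [:: inl i, inr (inr t) & w]; rewrite /= !eqxx; split=> //.
by rewrite sw mulnS.
Qed.

(* A walk alternates at best between the [v_i] and the [b_i], so its length is
   governed by the number of changes of index. *)
Definition gamma_index (v : vertex Gamma) : 'I_m :=
  match v with inl i => i | inr i => i end.

Lemma walk_gedge v (w : seq (arrow Gamma)) : is_walk v w ->
  exists s, path gedge (gamma_index v) s /\
    (size w <= 2 * size s + (if v is inl _ then 1 else 0))%N.
Proof.
elim: w v => [|a w IH] v /=; first by exists [::].
move=> /andP[/eqP <- /IH[s [hs sw]]].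
case: a hs sw => [i|[t|t]] /= hs sw.
- by exists s; split=> //; rewrite addn1 ltnS -[(2 * _)%N]addn0.
- exists ((tag t).2 :: s); split.
    by rewrite /= hs andbT /gedge /tedge; exact: leq_ltn_trans (ltn_ord (tagged t)).
  by rewrite /= mulnS addn1 ltnS add2n ltnW // ltnS -addn1.
- exists ((tag t).2 :: s); split.
    by rewrite /= hs andbT /gedge /tedge; exact: leq_ltn_trans (ltn_ord (tagged t)).
  by rewrite /= mulnS addn0 add2n ltnS -addn1.
Qed.

Lemma path_tedge (p : qpath Gamma) :
  exists i s, path (tedge V W) i s /\ (plength p <= 2 * size s + 1)%N.
Proof.
have wp : is_walk (psrc p) (parrows p) by case: (p).
have [s [/gedge_path[i [s' [hs' e]]] sw]] := walk_gedge wp.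
exists i, s'; split=> //; rewrite e; apply: (leq_trans sw).
by rewrite leq_add2l; case: (psrc p).
Qed.

Lemma tedge_long_path i s : path (tedge V W) i s ->
  exists p : qpath Gamma, plength p = (2 * size s).+1.
Proof.
by move=> /tedge_path[i' [s' [/gedge_walk[w [hw sw]] <-]]]; exists (mk_path hw).
Qed.

End Gamma.

Lemma gl_dim_le_leq (R : pzRingType) d d' : (d <= d')%N -> gl_dim_le R d -> gl_dim_le R d'.
Proof.
by move=> dd /gl_dim_le_pdx H; apply/gl_dim_le_pdx => M; apply: pdx_leq (H M).
Qed.

Theorem theorem4p11 (K : fieldType) (n m k : nat)
    (V W : 'I_m -> {vspace 'rV[K]_n})
    (infK : infinite_set [set: K]) (m_ge1 : (1 <= m)%N) (k_bounds : (0 < k < n)%N)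
    (dimV : forall i, \dim (V i) = k)
    (codimW : forall i, (n - \dim (W i))%N = k) :
  (finite_gl_dim (algR V W) <-> acyclic (quiverGamma V W)) /\
  (acyclic (quiverGamma V W) ->
     exists l : nat, max_path_length (quiverGamma V W) l
                     /\ gl_dim_eq (algR V W) (l + 2)%N).
Proof.
have /andP[k0 kn] := k_bounds; pose h := (n - k)%N.
have h0 : (0 < h)%N by rewrite subn_gt0.
have kh : (k + h)%N = n by rewrite subnKC // ltnW.
have dimW i : \dim (W i) = h.
  rewrite /h -(codimW i) subKn //.
  by rewrite (leq_trans (dimvS (subvf _))) // dimvf /dim /= mul1n.
have fV i : frame (V i) k h.
  have /cid[f _] : exists f : frame (V i) k h, True.
    by have [f] := frame_exists (dimV i) kh; exists f.
  exact: f.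
have fW i : frame (W i) h k.
  have /cid[f _] : exists f : frame (W i) h k, True.
    have hk : (h + k)%N = n by rewrite addnC.
    by have [f] := frame_exists (dimW i) hk; exists f.
  exact: f.
(* Stated for every path and without acyclicity, so it serves both the exact value and the exclusion
   of cycles. *)
have lower d (p : qpath (quiverGamma V W)) :
    gl_dim_le (algR V W) d -> (plength p + 2 <= d)%N.
  move=> gd; have [i [s [is_ ps]]] := path_tedge p.
  apply: leq_trans (gl_dim_lb fV fW k0 h0 is_ gd).
  by rewrite (leq_trans (leq_add ps (leqnn 2))) // -addnA.
have main : acyclic (quiverGamma V W) -> exists l : nat,
    max_path_length (quiverGamma V W) l /\ gl_dim_eq (algR V W) (l + 2)%N.
  move=> ac; have [l lmax] := acyclic_max_path (inl (Ordinal m_ge1) : vertex (quiverGamma V W)) ac.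
  exists l; split=> //; have [[p pl] pmax] := lmax; split; last first.
    by move=> d; rewrite -pl; exact: lower.
  (* A chain of [s] edges gives a path of length [2 s + 1 <= l], so [s] is less than half of
     [l + 1]. Rounding that half down is harmless, as its double is still at most [l + 1]; the
     parity of [l] need not be known. *)
  apply: (@gl_dim_le_leq _ (2 * l.+1./2).+1); last first.
    apply: (gl_dim_ub fV fW) => i s /tedge_long_path[q qE].
    by rewrite -(doubleK (size s).+1) half_leq // doubleS ltnS -mul2n -qE pmax.
  rewrite addn2 ltnS mul2n -[leqRHS]odd_double_half.
  exact: leq_addl.
split=> //; split=> [[d gd]|/main[l [_ [gl _]]]]; last by exists (l + 2)%N.
(* A cycle would yield paths longer than the assumed bound [d]. *)
apply: contrapT => nac; have [p pd] := @not_acyclic_long _ d.+1 nac.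
by have := leq_trans pd (leq_trans (leq_addr 2 _) (lower d p gd)); rewrite ltnn.
Qed.
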